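(* Consider an MPRK scheme of order $p=3$ based on a $3$-stage explicit Runge--Kutta scheme of order $3$ with non-negative Butcher array $(\mathbf A,\mathbf b,\mathbf c)$, applied to a positive and conservative production-destruction system with terms $p_{k\nu},d_{k\nu}\in\mathcal C^{4}$, and let $\boldsymbol\sigma=(\sigma_1,\dots,\sigma_N)^T$ be the vector of Patankar-weight denominators of its update $\mathbf y^{n+1}$. For $\theta\in[0,1]$ set $$\bar{\boldsymbol\sigma}(\theta)=(1-\theta)\mathbf y^n+\theta\boldsymbol\sigma,\qquad \bar b_1(\theta)=\theta-(1-b_1)\theta^2,\qquad \bar b_j(\theta)=\theta^2 b_j,\quad j=2,3.$$ Then the dense output formula $$y^{n+\theta}_k=y^n_k+\Delta t\sum_{j=1}^3\bar b_j(\theta)\sum_{\nu=1}^N\left(p_{k\nu}(\mathbf y^{(j)})\frac{y^{n+\theta}_\nu}{\bar\sigma_\nu(\theta)}-d_{k\nu}(\mathbf y^{(j)})\frac{y^{n+\theta}_k}{\bar\sigma_k(\theta)}\right),\quad k=1,\dots,N,$$ is convergent of order three.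
   Context: Production-destruction system (PDS). The autonomous initial value problem is $$y_k'(t)=f_k(\mathbf y(t))=\sum_{\nu=1}^N\bigl(p_{k\nu}(\mathbf y(t))-d_{k\nu}(\mathbf y(t))\bigr),\quad k=1,\dots,N,\quad \mathbf y(0)=\mathbf y^0>\mathbf 0,$$ with $p_{k\nu}(\mathbf y),d_{k\nu}(\mathbf y)\ge0$ for $\mathbf y>\mathbf 0$ (inequalities componentwise). It is positive if $\mathbf y(0)>\mathbf 0$ implies $\mathbf y(t)>\mathbf 0$ for all $t>0$, and conservative if $p_{k\nu}=d_{\nu k}$ for all $k,\nu$. MPRK scheme. For an explicit $s$-stage Runge--Kutta method with $\mathbf A,\mathbf b,\mathbf c\ge\mathbf 0$, the corresponding modified Patankar--Runge--Kutta (MPRK) scheme is $$y^{(i)}_k=y^n_k+\Delta t\sum_{j=1}^{i-1}a_{ij}\sum_{\nu=1}^N\left(p_{k\nu}(\mathbf y^{(j)})\frac{y^{(i)}_\nu}{\pi^{(i)}_\nu}-d_{k\nu}(\mathbf y^{(j)})\frac{y^{(i)}_k}{\pi^{(i)}_k}\right),\quad i=1,\dots,s,$$ $$y^{n+1}_k=y^n_k+\Delta t\sum_{j=1}^{s}b_j\sum_{\nu=1}^N\left(p_{k\nu}(\mathbf y^{(j)})\frac{y^{n+1}_\nu}{\sigma_\nu}-d_{k\nu}(\mathbf y^{(j)})\frac{y^{n+1}_k}{\sigma_k}\right),\quad k=1,\dots,N,$$ where the Patankar-weight denominators $\pi^{(i)}_\nu,\sigma_\nu$ are positive for any $\Delta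 t\ge0$ and independent of the corresponding numerators $y^{(i)}_k$ and $y^{n+1}_k$, respectively. The scheme is of order $p$ if $\mathbf y^{n+1}=\mathbf y(t^n+\Delta t)+\mathcal O(\Delta t^{p+1})$ whenever the exact solution satisfies $\mathbf y(t^n)=\mathbf y^n$ (and likewise for the underlying Runge--Kutta scheme, for every sufficiently smooth right-hand side); the order of an MPRK scheme is understood as a property of the scheme for all sufficiently smooth positive and conservative PDS, of any dimension $N$. In the dense output formula of the claim, the stages $\mathbf y^{(j)}$ are those of the MPRK scheme. Standing assumptions and conventions. $\bar{\boldsymbol\sigma}(\theta)>\mathbf 0$ is a continuous function of $\mathbf y^n$ and the stages. All $\mathcal O$-statements are as $\Delta t\to0$ and are understood, as usual, locally uniformly in $\mathbf y^n>\mathbf 0$. The dense output formula is convergent of order $q$ if on every bounded time interval $[0,T]$, with $t^n=n\Delta t$, $\mathbf y^n$ the MPRK approximations started at $\mathbf y^0=\mathbf y(0)$ and $\mathbf y(t)$ the exact solution, one has for $\theta\in[0,1]$ that $\max_{n:\,t^n+\Delta t\le T}\|\mathbf y^{n+\theta}-\mathbf y(t^n+\theta\Delta t)\|=\mathcal O(\Delta t^q)$.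
   Formalization: Added, since the claim fails for arbitrary system-dependent denominators: σ is locally Lipschitz in Δt, yⁿ and the stages; its value at Δt=0 with all stages equal to yⁿ is the same for every PDS; the stage denominators π are continuous in Δt, yⁿ and the stages. *)

(* Defs.v *)
From HB Require Import structures.
From mathcomp Require Import all_boot all_order all_algebra.
From mathcomp Require Import all_classical all_reals all_analysis.
Set Implicit Arguments.
Unset Strict Implicit.
Unset Printing Implicit Defensive.
Import Order.TTheory GRing.Theory Num.Theory.
Import numFieldNormedType.Exports.
Local Open Scope classical_set_scope.
Local Open Scope ring_scope.

(* R^N is 'rV[R]_N with the library's (maximum) norm.  The stages y^(1..s) of
   a step are the rows of a matrix in 'M[R]_(s, N).  Indices start at 0. *)

Definition orthant (R : realType) (m n : nat) : set 'M[R]_(m, n) :=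
  [set y | forall i k, 0 < y i k].
Arguments orthant R m n : clear implicits.

(* C^k on an open subset U of a finite-dimensional space V: all iterated
   directional derivatives up to order k exist and are continuous on U. *)
Fixpoint Ck (R : realType) (V W : normedModType R) (k : nat)
    (U : set V) (f : V -> W) : Prop :=
  match k with
  | 0 => forall x, U x -> {for x, continuous f}
  | k'.+1 => (forall x, U x -> {for x, continuous f}) /\
             (forall x v, U x -> derivable f x v) /\
             (forall v, Ck k' U ('D_v f))
  end.

(* z solves z' = g(t, z) on [a, b]. *)
Definition solves (R : realType) (N : nat) (g : R -> 'rV[R]_N -> 'rV[R]_N)
    (a b : R) (z : R -> 'rV[R]_N) : Prop :=
  {within `[a, b], continuous z} /\
  (forall t : R, a < t < b -> is_derive t 1 (z : R^o -> 'rV[R]_N) (g t (z t))).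

(** Production-destruction systems *)

(* Only the values of the terms on the positive orthant are meaningful. *)
Record pds (R : realType) (N : nat) := PDS {
  prod_term : 'rV[R]_N -> 'M[R]_N;
  dest_term : 'rV[R]_N -> 'M[R]_N }.

Definition pds_rhs (R : realType) (N : nat) (F : pds R N) (y : 'rV[R]_N) :
    'rV[R]_N :=
  \row_k \sum_nu (prod_term F y k nu - dest_term F y k nu).

Definition pds_solves (R : realType) (N : nat) (F : pds R N) (T : R)
    (z : R -> 'rV[R]_N) : Prop :=
  solves (fun _ => pds_rhs F) 0 T z.

Definition nonneg_pds (R : realType) (N : nat) (F : pds R N) : Prop :=
  forall y, orthant R 1 N y -> forall k nu,
    0 <= prod_term F y k nu /\ 0 <= dest_term F y k nu.

Definition conservative_pds (R : realType) (N : nat) (F : pds R N) : Prop :=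
  forall y, orthant R 1 N y -> forall k nu,
    prod_term F y k nu = dest_term F y nu k.

(* "y(0) > 0 implies y(t) > 0 for all t > 0", including that the solution
   exists for all times. *)
Definition positive_pds (R : realType) (N : nat) (F : pds R N) : Prop :=
  forall y0, orthant R 1 N y0 ->
    (exists z, z 0 = y0 /\ forall T, 0 < T -> pds_solves F T z) /\
    (forall T z, 0 < T -> z 0 = y0 -> pds_solves F T z ->
       forall t, 0 <= t <= T -> orthant R 1 N (z t)).

Definition Ck_pds (R : realType) (N k : nat) (F : pds R N) : Prop :=
  forall i nu,
    Ck k (orthant R 1 N) (fun y => prod_term F y i nu : R^o) /\
    Ck k (orthant R 1 N) (fun y => dest_term F y i nu : R^o).

Definition pc_pds (R : realType) (N k : nat) (F : pds R N) : Prop :=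
  [/\ nonneg_pds F, conservative_pds F, positive_pds F & Ck_pds k F].

(** Runge-Kutta schemes *)

Record butcher (R : realType) (s : nat) := Butcher {
  bt_A : 'M[R]_s;
  bt_b : 'I_s -> R;
  bt_c : 'I_s -> R }.

Definition explicit_rk (R : realType) (s : nat) (B : butcher R s) : Prop :=
  forall i j : 'I_s, (i <= j)%N -> bt_A B i j = 0.

Definition nonneg_rk (R : realType) (s : nat) (B : butcher R s) : Prop :=
  [/\ forall i j, 0 <= bt_A B i j, forall j, 0 <= bt_b B j
    & forall j, 0 <= bt_c B j].

Definition rk_step (R : realType) (s N : nat) (B : butcher R s)
    (g : R -> 'rV[R]_N -> 'rV[R]_N) (t dt : R) (yn : 'rV[R]_N)
    (Y : 'M[R]_(s, N)) (y1 : 'rV[R]_N) : Prop :=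
  (forall i, row i Y =
     yn + dt *: \sum_j bt_A B i j *: g (t + bt_c B j * dt) (row j Y)) /\
  y1 = yn + dt *: \sum_j bt_b B j *: g (t + bt_c B j * dt) (row j Y).

Definition rk_order (R : realType) (s p : nat) (B : butcher R s) : Prop :=
  forall (N : nat) (g : R -> 'rV[R]_N -> 'rV[R]_N),
    Ck p.+1 [set: R^o * 'rV[R]_N] (fun x : R^o * 'rV[R]_N => g x.1 x.2) ->
  forall (t0 : R) (y0 : 'rV[R]_N),
  exists (delta h C : R), [/\ 0 < delta, 0 < h &
    forall (t dt : R) (yn : 'rV[R]_N) Y y1 z,
      `|t - t0| < delta -> `|yn - y0| < delta -> 0 < dt <= h ->
      z t = yn -> solves g t (t + dt) z ->
      rk_step B g t dt yn Y y1 ->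
      `|y1 - z (t + dt)| <= C * dt ^+ p.+1].

(** Modified Patankar-Runge-Kutta schemes *)

(* y_k = y^n_k + dt sum_j w_j sum_nu (p_{k nu}(y^(j)) y_nu / den_nu
                                      - d_{k nu}(y^(j)) y_k / den_k) *)
Definition patankar (R : realType) (s N : nat) (F : pds R N) (dt : R)
    (w : 'I_s -> R) (Y : 'M[R]_(s, N)) (den yn y : 'rV[R]_N) : Prop :=
  forall k, y 0 k = yn 0 k + dt * \sum_j w j * \sum_nu
    (prod_term F (row j Y) k nu * (y 0 nu / den 0 nu)
     - dest_term F (row j Y) k nu * (y 0 k / den 0 k)).

(* A scheme comes with rules that assign to every system, of any dimension,
   the Patankar-weight denominators as functions of (dt, y^n, stages).  Being
   functions of these arguments, they do not see the numerators: pi^(i) uses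
   only the stages before the i-th one (see is_mprk), and y^{n+1} is not an
   argument of sigma. *)
Record mprk (R : realType) (s : nat) := MPRK {
  mprk_rk :> butcher R s;
  mprk_pi : forall N, pds R N -> 'I_s ->
    R^o * 'rV[R]_N * 'M[R]_(s, N) -> 'rV[R]_N;
  mprk_sigma : forall N, pds R N ->
    R^o * 'rV[R]_N * 'M[R]_(s, N) -> 'rV[R]_N }.

Definition pwd_dom (R : realType) (s N : nat) :
    set (R^o * 'rV[R]_N * 'M[R]_(s, N)) :=
  [set x | [/\ 0 <= x.1.1, orthant R 1 N x.1.2 & orthant R s N x.2]].
Arguments pwd_dom R s N : clear implicits.

Record is_mprk (R : realType) (s k : nat) (M : mprk R s) : Prop := IsMPRK {
  mprk_explicit : explicit_rk M;
  mprk_nonneg : nonneg_rk M;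
  mprk_pi_gt0 : forall N (F : pds R N) i x, pc_pds k F -> pwd_dom R s N x ->
    orthant R 1 N (mprk_pi M F i x);
  mprk_pi_continuous : forall N (F : pds R N) i, pc_pds k F ->
    {within pwd_dom R s N, continuous (mprk_pi M F i)};
  mprk_pi_earlier : forall N (F : pds R N) (i : 'I_s) dt yn Y Y', pc_pds k F ->
    (forall j : 'I_s, (j < i)%N -> row j Y = row j Y') ->
    mprk_pi M F i (dt, yn, Y) = mprk_pi M F i (dt, yn, Y');
  mprk_sigma_gt0 : forall N (F : pds R N) x, pc_pds k F -> pwd_dom R s N x ->
    orthant R 1 N (mprk_sigma M F x);
  (* Mere continuity of sigma would admit order-three schemes whose sigma
     deviates from y^n by dt^(1/2) along the kernel of the Patankar matrix. *)
  mprk_sigma_lipschitz : forall N (F : pds R N), pc_pds k F ->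
    [locally [lipschitz mprk_sigma M F x | x in pwd_dom R s N]];
  (* The system enters the denominators only through dt * p and dt * d, so
     that at dt = 0, where all the stages equal y^n, sigma depends on y^n
     alone. *)
  mprk_sigma0 : forall N (F G : pds R N) yn, pc_pds k F -> pc_pds k G ->
    orthant R 1 N yn ->
    mprk_sigma M F (0, yn, \matrix_(_ < s) yn) =
    mprk_sigma M G (0, yn, \matrix_(_ < s) yn) }.

(* The stage sums run up to i - 1 because the tableau is explicit. *)
Definition mprk_step (R : realType) (s N : nat) (M : mprk R s) (F : pds R N)
    (dt : R) (yn : 'rV[R]_N) (Y : 'M[R]_(s, N)) (y1 : 'rV[R]_N) : Prop :=
  (forall i, patankar F dt (bt_A M i) Y (mprk_pi M F i (dt, yn, Y)) yn
               (row i Y)) /\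
  patankar F dt (bt_b M) Y (mprk_sigma M F (dt, yn, Y)) yn y1.

Definition mprk_order (R : realType) (s p : nat) (M : mprk R s) : Prop :=
  forall (N : nat) (F : pds R N), pc_pds p.+1 F ->
  forall y0, orthant R 1 N y0 ->
  exists (delta h C : R), [/\ 0 < delta, 0 < h &
    forall (dt : R) (yn : 'rV[R]_N) Y y1 z,
      orthant R 1 N yn -> `|yn - y0| < delta -> 0 < dt <= h ->
      z 0 = yn -> pds_solves F dt z ->
      mprk_step M F dt yn Y y1 ->
      `|y1 - z dt| <= C * dt ^+ p.+1].

(** Dense output *)

(* bbar theta j are the weights and sbar theta y^n sigma the denominators of
   the formula for y^{n+theta}; the error bound is uniform in theta. *)
Definition dense_convergent (R : realType) (s N q : nat) (M : mprk R s)
    (F : pds R N) (bbar : R -> 'I_s -> R)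
    (sbar : R -> 'rV[R]_N -> 'rV[R]_N -> 'rV[R]_N) : Prop :=
  forall y0, orthant R 1 N y0 ->
  forall (T : R) (z : R -> 'rV[R]_N), 0 < T -> z 0 = y0 -> pds_solves F T z ->
  exists (h C : R), 0 < h /\
    forall (dt : R) (y : nat -> 'rV[R]_N) (Y : nat -> 'M[R]_(s, N)),
      0 < dt <= h -> y 0%N = y0 ->
      (forall n : nat, n.+1%:R * dt <= T ->
         mprk_step M F dt (y n) (Y n) (y n.+1)) ->
      forall (n : nat) (theta : R) (ytheta : 'rV[R]_N),
        n.+1%:R * dt <= T -> 0 <= theta <= 1 ->
        patankar F dt (bbar theta) (Y n)
          (sbar theta (y n) (mprk_sigma M F (dt, y n, Y n))) (y n) ytheta ->
        `|ytheta - z (n%:R * dt + theta * dt)| <= C * dt ^+ q.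

(* Main.v *)
Require Import Defs.
From mathcomp Require Import all_boot all_order all_algebra.
From mathcomp Require Import all_classical all_reals all_analysis.
From mathcomp Require Import ring lra.
Set Implicit Arguments.
Unset Strict Implicit.
Unset Printing Implicit Defensive.
Import Order.TTheory GRing.Theory Num.Theory.
Import numFieldNormedType.Exports.
Local Open Scope classical_set_scope.
Local Open Scope ring_scope.

(** Why the dense output is of order three.

    Let q be the quadratic polynomial in theta with value y0 and slope
    dt f(y0) at theta = 0 and with value y1 at theta = 1, that is
    q(theta) = y0 + (theta - theta^2) dt f(y0) + theta^2 (y1 - y0).

    An exact solution differs from its own quadratic q by O(dt^3), because
    quadratic polynomials in t are reproduced and the Taylor remainder of
    order two is O(dt^3): lemma [solution_hermite].

    The dense output also differs by O(dt^3) from the quadratic built on y^n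
    and y^(n+1).  Its weights put theta - theta^2 on the first stage, which is
    y^n, and theta^2 b_j on the stages of the update.  If v(theta) and v(1)
    denote the Patankar ratios, numerator over denominator, of the dense
    output and of the update, then v(theta) - 1 = theta (v(1) - 1) + O(dt^2),
    since numerators and denominators are affine in theta up to O(dt^2), and
    the terms of order dt^2 of the two formulas cancel: lemma
    [dense_expansion_sigma].  Besides sum b = 1 ([rk_order_sum]) this uses that
    the stages and sigma are y^n + O(dt).  For the stages this follows by
    induction ([stage_increment]).  For sigma it is a consequence of Lipschitz
    continuity and of sigma = y^n at dt = 0, and the latter is seen by applying
    the scheme to a linear system that moves mass between two components
    ([sigma_at_zero]).

    The quadratic q depends on y0 and y1 in a Lipschitz continuous way, so the
    error of the dense output is bounded by the errors of the scheme at the two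
    ends of the step, up to O(dt^3).  Those are O(dt^3) by the usual
    propagation of local errors ([dense_output_convergent]); the constants are
    uniform because the exact trajectory is compact
    ([step_estimates_compact]). *)

(** * Estimates along families of steps *)

Section BigO.
Context (R : realType) (I : Type) (Fi : set_system I) {FF : Filter Fi}.
Implicit Types (g h u v : I -> R).

(** The index type and the filter are arbitrary: a constant found along a
    family of steps is uniform in all the data that the index carries, such as
    the initial value, the stages and theta. *)
Definition isO g u := exists C, \forall i \near Fi, `|u i| <= C * `|g i|.

Lemma isO_pos g u : isO g u ->
  exists2 C, 0 < C & \forall i \near Fi, `|u i| <= C * `|g i|.
Proof.
move=> [C hC]; exists (Num.max C 1); first by rewrite lt_max ltr01 orbT.
apply: filterS hC => i /le_trans; apply.
by rewrite ler_wpM2r // le_max lexx.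
Qed.

Lemma isO_near g u v : (\forall i \near Fi, u i = v i) -> isO g u -> isO g v.
Proof. by move=> e [C hC]; exists C; apply: filterS2 e hC => i ->. Qed.

Lemma isO_eq g u v : u =1 v -> isO g u -> isO g v.
Proof. by move=> e; apply: isO_near; exact: nearW. Qed.

Lemma isO_le g u v : (\forall i \near Fi, `|u i| <= `|v i|) -> isO g v -> isO g u.
Proof.
by move=> e [C hC]; exists C; apply: filterS2 e hC => i; exact: le_trans.
Qed.

Lemma isO_trans g h u : isO g h -> isO h u -> isO g u.
Proof.
move=> [C hC] /isO_pos[D D0 hD]; exists (D * C); apply: filterS2 hC hD => i gi.
by move=> /le_trans; apply; rewrite -mulrA ler_pM2l.
Qed.

Lemma isO_refl g : isO g g.
Proof. by exists 1; apply: nearW => i; rewrite mul1r. Qed.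

Lemma isOD g u v : isO g u -> isO g v -> isO g (fun i => u i + v i).
Proof.
move=> [C hC] [D hD]; exists (C + D); apply: filterS2 hC hD => i ui vi.
by rewrite mulrDl (le_trans (ler_normD _ _)) // lerD.
Qed.

Lemma isON g u : isO g u -> isO g (fun i => - u i).
Proof. by apply: isO_le; apply: nearW => i; rewrite normrN. Qed.

Lemma isOB g u v : isO g u -> isO g v -> isO g (fun i => u i - v i).
Proof. by move=> hu /isON; exact: isOD. Qed.

Lemma isO0 g : isO g (fun=> 0).
Proof. by exists 0; apply: nearW => i; rewrite normr0 mul0r. Qed.

Lemma isO_sum (J : Type) (s : seq J) (P : pred J) g (u : J -> I -> R) :
  (forall j, P j -> isO g (u j)) -> isO g (fun i => \sum_(j <- s | P j) u j i).
Proof.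
move=> hu; elim: s => [|j s ih].
  by apply: isO_eq (isO0 g) => i; rewrite big_nil.
have [Pj|nPj] := boolP (P j); last first.
  by apply: isO_eq ih => i; rewrite big_cons (negbTE nPj).
by apply: isO_eq (isOD (hu j Pj) ih) => i; rewrite big_cons Pj.
Qed.

Lemma isOM g h u v : isO g u -> isO h v ->
  isO (fun i => g i * h i) (fun i => u i * v i).
Proof.
move=> /isO_pos[C C0 hC] [D hD]; exists (C * D).
apply: filterS2 hC hD => i ui vi; rewrite !normrM mulrACA.
by apply: ler_pM.
Qed.

Lemma isO_cst (c : R) : isO (fun=> 1) (fun=> c).
Proof. by exists `|c|; apply: nearW => i; rewrite normr1 mulr1. Qed.

Lemma isO_cvg u (l : R) : u @ Fi --> l -> isO (fun=> 1) u.
Proof.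
move=> /cvgrPdist_le /(_ 1 ltr01) h; exists (`|l| + 1).
apply: filterS h => i h; rewrite normr1 mulr1.
rewrite -[u i](subKr l) (le_trans (ler_normB _ _)) // lerD2l //.
Qed.

Lemma isO_inv u (m : R) : 0 < m -> (\forall i \near Fi, m <= u i) ->
  isO (fun=> 1) (fun i => (u i)^-1).
Proof.
move=> m0 h; exists m^-1; apply: filterS h => i mu.
have u0 := lt_le_trans m0 mu.
by rewrite normr1 mulr1 ger0_norm ?invr_ge0 ?(ltW u0) // lef_pV2.
Qed.

Section powers.
Variable dt : I -> R.
Hypothesis dt_to0 : dt @ Fi --> (0 : R).

Definition Odt m u := isO (fun i => dt i ^+ m) u.

Lemma Odt_near m u v : (\forall i \near Fi, u i = v i) -> Odt m u -> Odt m v.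
Proof. exact: isO_near. Qed.

Lemma Odt_eq m u v : u =1 v -> Odt m u -> Odt m v.
Proof. exact: isO_eq. Qed.

Lemma Odt_dt : Odt 1 dt.
Proof. by apply: isO_eq (isO_refl _) => i; rewrite expr1. Qed.

Lemma OdtD m u v : Odt m u -> Odt m v -> Odt m (fun i => u i + v i).
Proof. exact: isOD. Qed.

Lemma OdtB m u v : Odt m u -> Odt m v -> Odt m (fun i => u i - v i).
Proof. exact: isOB. Qed.

Lemma OdtM m n u v : Odt m u -> Odt n v -> Odt (m + n) (fun i => u i * v i).
Proof.
move=> hu hv; have [C hC] := isOM hu hv; exists C.
by apply: filterS hC => i; rewrite exprD.
Qed.

Lemma Odt_cst (c : R) : Odt 0 (fun=> c).
Proof.
by have [C hC] := isO_cst c; exists C; apply: filterS hC => i; rewrite expr0.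
Qed.

Lemma Odt0 u : isO (fun=> 1) u -> Odt 0 u.
Proof. by move=> [C hC]; exists C; apply: filterS hC => i; rewrite expr0. Qed.

Lemma Odt_sum (J : Type) (s : seq J) (P : pred J) m (u : J -> I -> R) :
  (forall j, P j -> Odt m (u j)) -> Odt m (fun i => \sum_(j <- s | P j) u j i).
Proof. exact: isO_sum. Qed.

Lemma Odt_weak m n u : (m <= n)%N -> Odt n u -> Odt m u.
Proof.
move=> /subnKC <-; apply: isO_trans.
exists 1; move/cvgr0Pnorm_le : dt_to0 => /(_ 1 ltr01); apply: filterS => i h.
by rewrite mul1r exprD normrM ler_piMr // normrX exprn_ile1.
Qed.

Lemma Odt_cvg0 u : Odt 1 u -> u @ Fi --> (0 : R).
Proof.
move=> /isO_pos[C C0 hC]; apply/cvgr0Pnorm_le => e e0.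
have eC0 : 0 < e / C by rewrite divr_gt0.
move/cvgr0Pnorm_le : dt_to0 => /(_ _ eC0); apply: filterS2 hC => i + h.
rewrite expr1 => /le_trans; apply.
by rewrite mulrC -ler_pdivlMr.
Qed.

Lemma Odt_dist_cvg u v (l : R) :
  Odt 1 (fun i => u i - v i) -> v @ Fi --> l -> u @ Fi --> l.
Proof.
move=> /Odt_cvg0 h hv; rewrite (_ : u = fun i => (u i - v i) + v i).
  by rewrite -[l]add0r; exact: cvgD.
by apply/funext => i; rewrite subrK.
Qed.

End powers.
End BigO.

(** * Maximum norm and mean values along coordinates *)

Lemma exists_small (R : realType) (P : R -> Prop) :
  (\forall r \near (0 : R)^'+, P r) -> exists2 r, 0 < r & P r.
Proof.
move=> h; have H : \forall r \near (0 : R)^'+, 0 < r /\ P r.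
  by near=> r; split; near: r; [exact: nbhs_right_gt|exact: h].
by have [r [r0 Pr]] := filter_ex H; exists r.
Unshelve. all: by end_near.
Qed.

Section MatrixNorm.
Context (R : realType) (m n : nat).
Implicit Types x : 'M[R]_(m, n).

Lemma coord_le_norm x i j : `|x i j| <= `|x|.
Proof.
by rewrite [leRHS]/Num.Def.normr/= mx_normrE; exact: (le_bigmax _ _ (i, j)).
Qed.

Lemma mx_norm_leP x (c : R) : 0 <= c ->
  `|x| <= c <-> forall i j, `|x i j| <= c.
Proof.
move=> c0; split=> [xc i j|xc]; first exact: le_trans (coord_le_norm x i j) xc.
by rewrite /Num.Def.normr/= mx_normrE bigmax_le.
Qed.

Lemma mx_norm_le_sum x : `|x| <= \sum_i \sum_j `|x i j|.
Proof.
apply/mx_norm_leP => [|i j].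
  by apply: sumr_ge0 => i _; apply: sumr_ge0.
rewrite (bigD1 i) //= (bigD1 j) //= -addrA lerDl.
by apply: addr_ge0; apply: sumr_ge0 => // k _; apply: sumr_ge0.
Qed.

Lemma cvg_mxP (I : Type) (Fi : set_system I) {FF : Filter Fi}
    (u : I -> 'M[R]_(m, n)) (l : 'M[R]_(m, n)) :
  (forall i j, (u k i j) @[k --> Fi] --> l i j) -> u @ Fi --> l.
Proof.
move=> h; apply/cvgrPdist_le => e e0.
have : \forall k \near Fi, forall i j, `|l i j - u k i j| <= e.
  apply: filter_forall => i; apply: filter_forall => j.
  exact: ((cvgrPdist_le _ _).1 (h i j)).
apply: filterS => k hk; apply/mx_norm_leP; first exact: ltW.
by move=> i j; rewrite !mxE.
Qed.

Lemma cvg_coord (I : Type) (Fi : set_system I) {FF : Filter Fi}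
    (u : I -> 'M[R]_(m, n)) (l : 'M[R]_(m, n)) i j :
  u @ Fi --> l -> (u k i j) @[k --> Fi] --> l i j.
Proof. by move=> h; exact: (cvg_comp _ _ h (@coord_continuous _ m n i j l)). Qed.

Lemma isO_norm (I : Type) (Fi : set_system I) {FF : Filter Fi} (g : I -> R)
    (u : I -> 'M[R]_(m, n)) :
  (forall i j, isO Fi g (fun k => u k i j)) -> isO Fi g (fun k => `|u k|).
Proof.
move=> h; have : isO Fi g (fun k => \sum_i \sum_j `|u k i j|).
  apply: isO_sum => i _; apply: isO_sum => j _.
  by apply: isO_le (h i j); apply: nearW => k; rewrite normr_id.
apply: isO_le; apply: nearW => k; rewrite normr_id.
by rewrite (le_trans (mx_norm_le_sum _)) // ler_norm.
Qed.

(** The same r is a radius and a lower bound for the entries, so that the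
    reciprocals of nearby denominators are bounded by 1 / r. *)
Lemma orthant_ball (x0 : 'M[R]_(m, n)) : orthant R m n x0 ->
  \forall r \near (0 : R)^'+, forall x, `|x - x0| <= r -> forall i j, r <= x i j.
Proof.
move=> hx0; have : \forall r \near (0 : R)^'+, forall i j, r <= x0 i j / 2.
  apply: filter_forall => i; apply: filter_forall => j.
  by apply: nbhs_right_ltW; rewrite divr_gt0.
apply: filterS => r hr x hx i j.
have := le_trans (coord_le_norm (x - x0) i j) hx; rewrite !mxE => h.
by have := hr i j; move: h; rewrite ler_norml => /andP[]; lra.
Qed.

Lemma orthant_nbhs (x0 : 'M[R]_(m, n)) : orthant R m n x0 ->
  \forall x \near x0, orthant R m n x.
Proof.
move=> /orthant_ball /exists_small[r r0 h].
have /cvgrPdist_le /(_ r r0) : x @[x --> x0] --> x0 by exact: cvg_id.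
apply: filterS => x hx i j.
by apply: lt_le_trans r0 (h x _ i j); rewrite distrC.
Qed.

End MatrixNorm.

Section CoordinateMeanValue.
Context (R : realType) (N : nat).
Implicit Types (g : 'rV[R]_N -> R^o) (x y : 'rV[R]_N).

Lemma is_derive_line g (q e : 'rV[R]_N) (s : R) :
  derivable g (q + s *: e) e ->
  is_derive s 1 (fun t : R => g (q + t *: e)) ('D_e g (q + s *: e)).
Proof.
move=> dg.
have E : (fun h : R => h^-1 *:
    (((fun t : R => g (q + t *: e)) \o shift s) (h *: (1 : R))
      - g (q + s *: e)) : R^o) =
  (fun h : R => h^-1 *: ((g \o shift (q + s *: e)) (h *: e) - g (q + s *: e))).
  apply/funext => h /=; congr (_ *: (g _ - _)).
  by rewrite [h *: 1]mulr1 scalerDl addrCA.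
by apply: DeriveDef; rewrite /derivable /derive E.
Qed.

Lemma mean_value_line g (q e : 'rV[R]_N) (a : R) (U : set 'rV[R]_N) :
  (forall x, U x -> {for x, continuous g}) ->
  (forall x, U x -> derivable g x e) ->
  (forall s, 0 <= s <= 1 -> U (q + (s * a) *: e)) ->
  exists2 s, 0 <= s <= 1 &
    g (q + a *: e) - g q = 'D_e g (q + (s * a) *: e) * a.
Proof.
move=> gc gd inU.
have cts b c : (forall t, t \in `[b, c] -> U (q + t *: e)) ->
    {within `[b, c], continuous (fun t : R => g (q + t *: e))}.
  move=> bcU; apply: continuous_in_subspaceT => t /set_mem tbc.
  apply: (@continuous_comp _ _ _ (fun t : R => q + t *: e) g); last first.
    by apply: gc; exact: bcU.
  by apply: cvgD; [exact: cvg_cst|apply: cvgZr_tmp; exact: cvg_id].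
have [a0|a0|<-] := ltgtP 0 a.
- have inU' t : t \in `[0, a] -> U (q + t *: e).
    rewrite in_itv/= => /andP[t0 ta]; have := inU (t / a).
    rewrite divfK ?gt_eqF //; apply.
    by rewrite divr_ge0 ?(ltW a0) //= ler_pdivrMr // mul1r.
  have [t|c ca] := @MVT R (fun t : R => g (q + t *: e))
    (fun s : R => 'D_e g (q + s *: e)) 0 a a0 _ (cts _ _ inU').
    by move=> ta; apply/is_derive_line/gd/inU'; exact: subset_itv_oo_cc.
  move/subset_itv_oo_cc: ca; rewrite in_itv/= => /andP[c0 ca].
  rewrite /= scale0r addr0 subr0 => ->; exists (c / a); last by rewrite divfK ?gt_eqF.
  by rewrite divr_ge0 ?(ltW a0) //= ler_pdivrMr // mul1r.
- have inU' t : t \in `[a, 0] -> U (q + t *: e).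
    rewrite in_itv/= => /andP[t0 ta]; have := inU (t / a).
    rewrite divfK ?lt_eqF //; apply.
    by rewrite ler_ndivlMr // ler_ndivrMr // mul0r mul1r t0 ta.
  have [t|c ca] := @MVT R (fun t : R => g (q + t *: e))
    (fun s : R => 'D_e g (q + s *: e)) a 0 a0 _ (cts _ _ inU').
    by move=> ta; apply/is_derive_line/gd/inU'; exact: subset_itv_oo_cc.
  move/subset_itv_oo_cc: ca; rewrite in_itv/= => /andP[c0 ca].
  rewrite /= scale0r addr0 sub0r => E.
  exists (c / a); first by rewrite ler_ndivlMr // ler_ndivrMr // mul0r mul1r ca c0.
  by rewrite divfK ?lt_eqF // -opprB E mulrN opprK.
- by exists 0; rewrite ?lexx ?ler01 // scale0r addr0 subrr mulr0.
Qed.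

Let unit_row (i : 'I_N) : 'rV[R]_N := delta_mx 0 i.

Let path_row (m : nat) x y : 'rV[R]_N :=
  \row_k if (k < m)%N then x 0 k else y 0 k.

(** The path from y to x changes one coordinate at a time, so that partial
    derivatives suffice and no total derivative has to be built from the
    directional ones. *)
Lemma coordinate_mean_value g (U : set 'rV[R]_N) x y :
  (forall z, U z -> {for z, continuous g}) ->
  (forall z v, U z -> derivable g z v) ->
  (forall z : 'rV[R]_N, (forall k, exists2 t, 0 <= t <= 1 &
       z 0 k = y 0 k + t * (x 0 k - y 0 k)) -> U z) ->
  exists2 xi : 'I_N -> 'rV[R]_N,
    (forall i k, exists2 t, 0 <= t <= 1 &
       xi i 0 k = y 0 k + t * (x 0 k - y 0 k)) &
    g x - g y = \sum_i 'D_(unit_row i) g (xi i) * (x 0 i - y 0 i).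
Proof.
move=> gc gd boxU.
have step (i : 'I_N) : exists z : 'rV[R]_N,
    (forall k, exists2 t, 0 <= t <= 1 & z 0 k = y 0 k + t * (x 0 k - y 0 k)) /\
    g (path_row i.+1 x y) - g (path_row i x y) =
      'D_(unit_row i) g z * (x 0 i - y 0 i).
  have box s k : 0 <= s <= 1 -> exists2 t, 0 <= t <= 1 &
      (path_row i x y + (s * (x 0 i - y 0 i)) *: unit_row i) 0 k =
      y 0 k + t * (x 0 k - y 0 k).
    move=> s01; rewrite !mxE eqxx /=; have [->|ki] := eqVneq k i.
      by exists s => //; rewrite ltnn mulr1.
    rewrite mulr0 addr0; case: ifP => _.
      by exists 1; rewrite ?ler01 ?lexx // mul1r subrKC.
    by exists 0; rewrite ?ler01 ?lexx // mul0r addr0.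
  have [s s01 E] := @mean_value_line g (path_row i x y) (unit_row i)
    (x 0 i - y 0 i) U gc (fun z => gd z _) (fun s s01 => boxU _ (box s ^~ s01)).
  exists (path_row i x y + (s * (x 0 i - y 0 i)) *: unit_row i).
  split; first by move=> k; exact: box.
  rewrite -E; congr (g _ - _); apply/rowP => k; rewrite !mxE eqxx /= ltnS.
  have [->|ki] := eqVneq k i; first by rewrite leqnn ltnn mulr1 subrKC.
  by rewrite mulr0 addr0 leq_eqVlt -val_eqE /= in ki *; rewrite (negbTE ki).
have [xi hxi] := choice step.
exists xi; first by move=> i; have [] := hxi i.
transitivity (\sum_(i < N) (g (path_row i.+1 x y) - g (path_row i x y))).
  rewrite -(big_mkord xpredT (fun i => g (path_row i.+1 x y) - g (path_row i x y))).
  rewrite telescope_sumr //; congr (g _ - g _); apply/rowP => k; rewrite !mxE //.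
  by rewrite ltn_ord.
by apply: eq_bigr => i _; have [] := hxi i.
Qed.

End CoordinateMeanValue.

(** * Lipschitz and quadratic bounds for smooth functions *)

Section SmoothFunctions.
Context (R : realType) (N : nat).
Implicit Types (g : 'rV[R]_N -> R^o) (x y z : 'rV[R]_N).

Lemma Ck_continuous (V W : normedModType R) k (U : set V) (f : V -> W) :
  Ck k U f -> forall x : V, U x -> {for x, continuous f}.
Proof. by case: k => [|k []]. Qed.

Lemma Ck_derive (V W : normedModType R) k (U : set V) (f : V -> W) (v : V) :
  Ck k.+1 U f -> Ck k U ('D_v f).
Proof. by move=> [_ [_]]; exact. Qed.

Lemma nbhs_closed_ball (V : normedModType R) (x0 : V) (P : V -> Prop) :
  (\forall x \near x0, P x) ->
  exists2 r : R, 0 < r & forall x : V, `|x - x0| <= r -> P x.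
Proof.
move=> /nbhs_ballP[r /= r0 h]; exists (r / 2) => [|x hx]; first by rewrite divr_gt0.
apply: h; rewrite -ball_normE /= distrC; apply: le_lt_trans hx _.
by rewrite ltr_pdivrMr // ltr_pMr // ltr1n.
Qed.

(** The closed balls of the maximum norm are boxes. *)
Lemma between_ball (x0 : 'rV[R]_N) x y z (r : R) :
  `|x - x0| <= r -> `|y - x0| <= r ->
  (forall k, exists2 t, 0 <= t <= 1 & z 0 k = y 0 k + t * (x 0 k - y 0 k)) ->
  `|z - x0| <= r /\ `|z - y| <= `|x - y|.
Proof.
move=> hx hy hz; split; apply/mx_norm_leP => //.
- exact: le_trans hx.
- move=> i k; rewrite (ord1 i) !mxE; have [t t01 ->] := hz k.
  have := le_trans (coord_le_norm (x - x0) 0 k) hx.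
  have := le_trans (coord_le_norm (y - x0) 0 k) hy.
  rewrite !mxE !ler_norml; move: t01 => /andP[t0 t1].
  move: (x 0 k) (y 0 k) (x0 0 k) => a b c /andP[h1 h2] /andP[h3 h4].
  apply/andP; split; nra.
- move=> i k; rewrite (ord1 i) !mxE; have [t t01 ->] := hz k.
  have := coord_le_norm (x - y) 0 k; rewrite !mxE.
  rewrite addrAC subrr add0r normrM; apply: le_trans.
  by rewrite ler_piMl // ger0_norm; move: t01 => /andP[].
Qed.

Lemma Ck1_mean_value k g (x0 : 'rV[R]_N) :
  Ck k.+1 (orthant R 1 N) g -> orthant R 1 N x0 ->
  \forall r \near (0 : R)^'+, forall x y, `|x - x0| <= r -> `|y - x0| <= r ->
  exists2 xi : 'I_N -> 'rV[R]_N,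
    (forall i, `|xi i - x0| <= r /\ `|xi i - y| <= `|x - y|) &
    g x - g y = \sum_i 'D_(delta_mx 0 i) g (xi i) * (x 0 i - y 0 i).
Proof.
move=> [gc [gd _]] /orthant_ball ox0; near=> r; move=> x y hx hy.
have r0 : 0 < r by near: r; exact: nbhs_right_gt.
have inO z : `|z - x0| <= r -> orthant R 1 N z.
  move=> hz i j; apply: lt_le_trans r0 _; move: z hz i j.
  by near: r; exact: ox0.
have [z hz|z v hz|z hz|xi hxi E] :=
    @coordinate_mean_value R N g [set z | `|z - x0| <= r] x y.
- exact/gc/inO.
- exact/gd/inO.
- by have [] := between_ball hx hy hz.
- by exists xi => // i; exact: between_ball.
Unshelve. all: by end_near. Qed.

Lemma Ck1_lipschitz k g (x0 : 'rV[R]_N) :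
  Ck k.+1 (orthant R 1 N) g -> orthant R 1 N x0 ->
  exists C, 0 <= C /\ \forall r \near (0 : R)^'+,
    forall x y, `|x - x0| <= r -> `|y - x0| <= r ->
      `|g x - g y| <= C * `|x - y|.
Proof.
move=> gk ox0; have [_ [_ gD]] := gk.
have Dc i : {for x0, continuous ('D_(delta_mx 0 i) g)}.
  exact: Ck_continuous (gD (delta_mx 0 i)) _ ox0.
pose M i := `|'D_(delta_mx 0 i) g x0| + 1.
exists (\sum_i M i); split; first by apply: sumr_ge0 => i _; rewrite addr_ge0.
have : \forall x \near x0, forall i, `|'D_(delta_mx 0 i) g x| <= M i.
  apply: (@filter_forall _ _ _ (nbhs x0)) => i.
  have /cvgrPdist_le /(_ 1 ltr01) := Dc i; apply: filterS => x.
  rewrite distrC => h; rewrite -lerBlDl; apply: le_trans h.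
  exact: lerB_dist.
move=> /nbhs_closed_ball[r1 r10 hM].
have := Ck1_mean_value gk ox0.
apply: filterS2 (nbhs_right_ltW r10) => r rr1 mv x y hx hy.
have [xi hxi ->] := mv _ _ hx hy.
rewrite (le_trans (ler_norm_sum _ _ _)) // mulr_suml; apply: ler_sum => i _.
rewrite normrM ler_pM //; first by apply: hM; apply: le_trans rr1; have [] := hxi i.
by have := coord_le_norm (x - y) 0 i; rewrite !mxE.
Qed.

Lemma Ck2_quadratic k g (x0 : 'rV[R]_N) :
  Ck k.+2 (orthant R 1 N) g -> orthant R 1 N x0 ->
  exists C, 0 <= C /\ \forall r \near (0 : R)^'+,
    forall x y, `|x - x0| <= r -> `|y - x0| <= r ->
      `|g x - g y - \sum_i 'D_(delta_mx 0 i) g y * (x 0 i - y 0 i)|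
        <= C * `|x - y| ^+ 2.
Proof.
move=> gk ox0; have [_ [_ gD]] := gk.
have [C hC] := choice (fun i => Ck1_lipschitz (gD (delta_mx 0 i)) ox0).
exists (\sum_i C i); split; first by apply: sumr_ge0 => i _; have [] := hC i.
have := Ck1_mean_value gk ox0.
have : \forall r \near (0 : R)^'+, forall i x y, `|x - x0| <= r -> `|y - x0| <= r ->
    `|'D_(delta_mx 0 i) g x - 'D_(delta_mx 0 i) g y| <= C i * `|x - y|.
  by apply: filter_forall => i; have [] := hC i.
apply: filterS2 => r lip mv x y hx hy.
have [xi hxi ->] := mv _ _ hx hy.
rewrite -sumrB (le_trans (ler_norm_sum _ _ _)) // mulr_suml; apply: ler_sum => i _.
have [C0 _] := hC i; have [xr xy] := hxi i.
rewrite -mulrBl normrM expr2 mulrA ler_pM //.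
  by apply: le_trans (lip i _ _ xr hy) _; rewrite ler_wpM2l.
by have := coord_le_norm (x - y) 0 i; rewrite !mxE.
Qed.

End SmoothFunctions.

(** * The production-destruction operator *)

Section BoundedFactor.
Context (R : realType) (I : Type) (Fi : set_system I) {FF : Filter Fi}.

Lemma isO_mulb (g u v : I -> R) : isO Fi (fun=> 1) u -> isO Fi g v ->
  isO Fi g (fun i => u i * v i).
Proof.
move=> hu hv; have [C hC] := isOM hu hv; exists C.
by apply: filterS hC => i; rewrite mul1r.
Qed.

Lemma cvg_within_dom (T : topologicalType) (D : set T) (q : I -> T) (p : T) :
  q @ Fi --> p -> (\forall i \near Fi, D (q i)) -> q @ Fi --> within D (nbhs p).
Proof.
move=> qp qD A; rewrite /within /= => /qp h.
by apply: filterS2 qD h => i Dq; exact.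
Qed.

End BoundedFactor.

Section Flux.
Context (R : realType) (N : nat) (F : pds R N).
Implicit Types (u v : 'I_N -> R) (y : 'rV[R]_N).

(** The production-destruction operator at y, linear in the Patankar ratios v;
    the right-hand side of the system is its value at v = 1. *)
Definition flux y v (k : 'I_N) : R :=
  \sum_nu (prod_term F y k nu * v nu - dest_term F y k nu * v k).

Lemma fluxB y u v k : flux y (fun nu => u nu - v nu) k = flux y u k - flux y v k.
Proof. by rewrite /flux -sumrB; apply: eq_bigr => nu _; ring. Qed.

Lemma fluxZ y c u k : flux y (fun nu => c * u nu) k = c * flux y u k.
Proof. by rewrite /flux mulr_sumr; apply: eq_bigr => nu _; ring. Qed.

Lemma flux1 y k : flux y (fun=> 1) k = pds_rhs F y 0 k.
Proof. by rewrite /pds_rhs mxE; apply: eq_bigr => nu _; rewrite !mulr1. Qed.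

Lemma eq_flux y u v k : u =1 v -> flux y u k = flux y v k.
Proof. by move=> /funext ->. Qed.

Lemma patankarP s dt (w : 'I_s -> R) (Y : 'M[R]_(s, N)) (den yn y : 'rV[R]_N) :
  patankar F dt w Y den yn y <-> forall k,
    y 0 k = yn 0 k + dt * \sum_j w j *
      flux (row j Y) (fun nu => y 0 nu / den 0 nu) k.
Proof. by []. Qed.

Lemma patankar_congr s dt (w : 'I_s -> R) (Y Z : 'M[R]_(s, N)) (den yn y : 'rV[R]_N) :
  (forall j, w j = 0 \/ row j Y = row j Z) ->
  patankar F dt w Y den yn y -> patankar F dt w Z den yn y.
Proof.
move=> h /patankarP hY; apply/patankarP => k; rewrite {1}hY.
congr (_ + _ * _); apply: eq_bigr => j _.
by case: (h j) => [->|->]; rewrite ?mul0r.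
Qed.

End Flux.

Section FluxEstimates.
Context (R : realType) (I : Type) (Fi : set_system I) {FF : Filter Fi}.
Context (N : nat) (x0 : 'rV[R]_N) (ox0 : orthant R 1 N x0).

Lemma Ck_bounded k (f : 'rV[R]_N -> R^o) (Z : I -> 'rV[R]_N) :
  Ck k (orthant R 1 N) f -> Z @ Fi --> x0 -> isO Fi (fun=> 1) (fun i => f (Z i)).
Proof.
move=> fk Zx0; apply: (@isO_cvg _ _ _ _ _ (f x0)).
by apply: (cvg_comp _ _ Zx0); exact: Ck_continuous fk _ ox0.
Qed.

Lemma Ck1_isO k (f : 'rV[R]_N -> R^o) (Z W : I -> 'rV[R]_N) :
  Ck k.+1 (orthant R 1 N) f -> Z @ Fi --> x0 -> W @ Fi --> x0 ->
  isO Fi (fun i => `|Z i - W i|) (fun i => f (Z i) - f (W i)).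
Proof.
move=> fk Zx0 Wx0; have [C [_ /exists_small[r r0 h]]] := Ck1_lipschitz fk ox0.
exists C; move/cvgrPdist_le : Zx0 => /(_ _ r0); move/cvgrPdist_le : Wx0 => /(_ _ r0).
apply: filterS2 => i hW hZ; rewrite normr_id.
by apply: h; rewrite distrC.
Qed.

Context (F : pds R N) (k : nat) (Fk : Ck_pds k.+1 F).

Lemma flux_isO (g : I -> R) (Z : I -> 'rV[R]_N) (v : I -> 'I_N -> R) l :
  Z @ Fi --> x0 -> (forall nu, isO Fi g (fun i => v i nu)) ->
  isO Fi g (fun i => flux F (Z i) (v i) l).
Proof.
move=> Zx0 hv; apply: isO_sum => nu _; have [Fp Fd] := Fk l nu.
by apply: isOB; apply: isO_mulb => //; [exact: Ck_bounded Fp _|exact: Ck_bounded Fd _].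
Qed.

Variable dt : I -> R.
Hypothesis dt_to0 : dt @ Fi --> (0 : R).

Lemma flux_Odt_diff m (Z W : I -> 'rV[R]_N) (v : I -> 'I_N -> R) l :
  Z @ Fi --> x0 -> W @ Fi --> x0 ->
  (forall nu, Odt Fi dt 1 (fun i => Z i 0 nu - W i 0 nu)) ->
  (forall nu, Odt Fi dt m (fun i => v i nu)) ->
  Odt Fi dt m.+1 (fun i => flux F (Z i) (v i) l - flux F (W i) (v i) l).
Proof.
move=> Zx0 Wx0 ZW hv.
have ZWn : isO Fi (fun i => dt i ^+ 1) (fun i => `|Z i - W i|).
  apply: isO_norm => a nu; rewrite (ord1 a).
  by apply: isO_eq (ZW nu) => i; rewrite !mxE.
have lip (f : 'rV[R]_N -> R^o) : Ck k.+1 (orthant R 1 N) f ->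
    Odt Fi dt 1 (fun i => f (Z i) - f (W i)).
  by move=> fk; apply: isO_trans ZWn _; exact: Ck1_isO fk Zx0 Wx0.
have : Odt Fi dt m.+1 (fun i => \sum_nu
    ((prod_term F (Z i) l nu - prod_term F (W i) l nu) * v i nu -
     (dest_term F (Z i) l nu - dest_term F (W i) l nu) * v i l)).
  rewrite -add1n; apply: Odt_sum => nu _; have [Fp Fd] := Fk l nu.
  exact: OdtB (OdtM (lip _ Fp) (hv nu)) (OdtM (lip _ Fd) (hv l)).
by apply: Odt_eq => i; rewrite -sumrB; apply: eq_bigr => nu _; ring.
Qed.

(** The matrix of the linear system for y is I + O(dt), which bounds y by
    2 |yn| and thereby the increment. *)
Lemma patankar_increment s (w : I -> 'I_s -> R) (Y : I -> 'M[R]_(s, N))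
    (den yn y : I -> 'rV[R]_N) :
  (forall j, isO Fi (fun=> 1) (fun i => w i j)) ->
  (forall j, row j (Y i) @[i --> Fi] --> x0) ->
  (forall nu, isO Fi (fun=> 1) (fun i => (den i 0 nu)^-1)) ->
  yn @ Fi --> x0 ->
  (\forall i \near Fi, patankar F (dt i) (w i) (Y i) (den i) (yn i) (y i)) ->
  forall l, Odt Fi dt 1 (fun i => y i 0 l - yn i 0 l).
Proof.
move=> wb Yx0 denb ynx0 pat l.
have step nu : isO Fi (fun i => dt i * `|y i|) (fun i => (y i - yn i) 0 nu).
  apply: (@isO_near _ _ _ _ _ (fun i => dt i * \sum_j w i j *
      flux F (row j (Y i)) (fun nu => y i 0 nu / den i 0 nu) nu)).
    by apply: filterS pat => i /patankarP h; rewrite !mxE [in RHS]h addrAC subrr add0r.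
  apply: isOM; first exact: isO_refl.
  apply: isO_sum => j _; apply: isO_mulb => //; 
  apply: (flux_isO (v := fun i nu => y i 0 nu / den i 0 nu)) => // mu.
  apply: (@isO_eq _ _ _ _ _ (fun i => (den i 0 mu)^-1 * y i 0 mu)).
    by move=> i; rewrite mulrC.
  apply: isO_mulb => //; exists 1; apply: nearW => i.
  by rewrite mul1r normr_id; exact: coord_le_norm.
have [C C0 hC] : exists2 C, 0 < C & \forall i \near Fi,
    `|y i - yn i| <= C * (`|dt i| * `|y i|).
  have [a nu|C C0 hC] := @isO_pos _ _ _ _ _ _ (@isO_norm R 1 N I Fi FF
      (fun i => dt i * `|y i|) (fun i => y i - yn i) _).
    by rewrite (ord1 a); exact: step.
  by exists C => //; apply: filterS hC => i; rewrite normr_id normrM normr_id.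
have ynb : isO Fi (fun=> 1) (fun i => `|yn i|).
  apply: isO_norm => a nu; apply: isO_cvg; exact: cvg_coord ynx0.
have [D hD] := ynb; exists (2 * C * D).
have C20 : 0 < (2 * C)^-1 by rewrite invr_gt0 mulr_gt0.
move/cvgr0Pnorm_le : (dt_to0) => /(_ _ C20).
apply: filterS3 hC hD => i hC hD hdt; rewrite normr1 mulr1 normr_id in hD.
have tri : `|y i| <= `|y i - yn i| + `|yn i|.
  by rewrite -{1}(subrK (yn i) (y i)) ler_normD.
rewrite expr1; have := coord_le_norm (y i - yn i) 0 l; rewrite !mxE.
move=> /le_trans; apply.
have dC : `|dt i| * C <= 1 / 2.
  move: hdt; rewrite -[leRHS]mul1r ler_pdivlMr ?mulr_gt0 //; lra.
set a := `|y i - yn i| in tri hC *; set b := `|y i| in tri hC *.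
have dt0 : 0 <= `|dt i| by [].
have a0 : 0 <= a by rewrite /a.
have : `|dt i| * C * b <= `|dt i| * C * (a + `|yn i|).
  by rewrite ler_wpM2l // mulr_ge0 // ltW.
have : `|dt i| * C * a <= 1 / 2 * a by rewrite ler_wpM2r.
have : `|dt i| * C * `|yn i| <= `|dt i| * C * D.
  by rewrite ler_wpM2l // mulr_ge0 // ltW.
lra.
Qed.

End FluxEstimates.

(** * Stages and denominators of a step *)

Section Stages.
Context (R : realType) (s k : nat) (M : mprk R s) (hM : is_mprk k.+1 M).
Context (N : nat) (F : pds R N) (hF : pc_pds k.+1 F).
Context (x0 : 'rV[R]_N) (ox0 : orthant R 1 N x0).
Context (I : Type) (Fi : set_system I) {FF : Filter Fi}.
Variables (dt : I -> R) (yn : I -> 'rV[R]_N) (Y : I -> 'M[R]_(s, N)).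
Hypothesis dt_to0 : dt @ Fi --> (0 : R).
Hypothesis dt_ge0 : \forall i \near Fi, 0 <= dt i.
Hypothesis yn_x0 : yn @ Fi --> x0.

Let base_point : R^o * 'rV[R]_N * 'M[R]_(s, N) := (0, x0, \matrix_(_ < s) x0).

Lemma orthant_const (n : nat) (y : 'rV[R]_N) : orthant R 1 N y ->
  orthant R n N (\matrix_(_ < n) y).
Proof. by move=> oy i j; rewrite mxE. Qed.

Lemma base_point_dom : pwd_dom R s N base_point.
Proof. by split=> //=; exact: orthant_const. Qed.

Lemma near_pwd_dom (Z : I -> 'M[R]_(s, N)) :
  Z @ Fi --> (\matrix_(_ < s) x0) ->
  ((dt i : R^o, yn i, Z i) @[i --> Fi] --> base_point) /\
  \forall i \near Fi, pwd_dom R s N (dt i, yn i, Z i).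
Proof.
move=> Zx0; split.
  have h : ((dt i : R^o, yn i) @[i --> Fi] --> ((0 : R^o), x0)).
    exact: (@cvg_pair _ _ _ Fi (nbhs (0 : R^o)) (nbhs x0) _ _ _ _ _ dt_to0 yn_x0).
  exact: (@cvg_pair _ _ _ Fi (nbhs (0 : R^o, x0)) (nbhs (\matrix_(_ < s) x0))
    _ _ _ _ _ h Zx0).
have oZ := Zx0 _ (orthant_nbhs (@orthant_const s _ ox0)).
have oy := yn_x0 (orthant_nbhs ox0).
by apply: filterS3 dt_ge0 oy oZ => i.
Qed.

Lemma const_stages_cvg : (\matrix_(_ < s) yn i) @[i --> Fi] --> \matrix_(_ < s) x0.
Proof.
apply: cvg_mxP => a b; rewrite mxE.
rewrite (_ : (fun i => _) = fun i => yn i 0 b); first exact: cvg_coord.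
by apply/funext => i; rewrite mxE.
Qed.

Hypothesis stages : \forall i \near Fi, forall l,
  patankar F (dt i) (bt_A M l) (Y i) (mprk_pi M F l (dt i, yn i, Y i)) (yn i)
    (row l (Y i)).

(** The denominators of a stage only see the earlier stages, which are
    y^n + O(dt) by induction; being continuous and positive, they stay away
    from zero. *)
Lemma stage_increment l nu : Odt Fi dt 1 (fun i => Y i l nu - yn i 0 nu).
Proof.
suff h m (l' : 'I_s) : (l' < m)%N ->
    forall nu, Odt Fi dt 1 (fun i => Y i l' nu - yn i 0 nu).
  exact: h (ltnSn l) nu.
elim: m l' => // m ih l'; rewrite ltnS => l'm mu.
(* The stages not yet controlled are replaced by y^n, which changes neither the
   denominators nor the equation of stage l'. *)
pose Z i := \matrix_(j < s, c < N) if (j < l')%N then Y i j c else yn i 0 c.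
have Zdist j c : Odt Fi dt 1 (fun i => Z i j c - yn i 0 c).
  have [jl|jl] := ltnP j l'.
    apply: Odt_eq (ih j (leq_trans jl l'm) c) => i.
    by rewrite mxE jl.
  have h0 : Odt Fi dt 1 (fun=> 0) by exact: isO0.
  by apply: Odt_eq h0 => i; rewrite mxE ltnNge jl subrr.
have Zx0 : Z @ Fi --> (\matrix_(_ < s) x0).
  apply: cvg_mxP => j c; rewrite mxE.
  by apply: (Odt_dist_cvg dt_to0 (Zdist j c)); exact: cvg_coord.
have [qp qD] := near_pwd_dom Zx0.
have pi_cvg : (mprk_pi M F l' (dt i, yn i, Z i)) @[i --> Fi] -->
    mprk_pi M F l' base_point.
  have /subspace_continuousP /(_ _ base_point_dom) :=
    @mprk_pi_continuous _ _ _ _ hM _ _ l' hF.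
  by apply: cvg_comp; exact: cvg_within_dom.
have pi_pos := @mprk_pi_gt0 _ _ _ _ hM _ _ l' _ hF base_point_dom.
suff h : Odt Fi dt 1 (fun i => row l' (Y i) 0 mu - yn i 0 mu).
  by apply: Odt_eq h => i; rewrite mxE.
apply: (@patankar_increment R I Fi FF N x0 ox0 F k _ dt dt_to0 s
  (fun=> bt_A M l') Z (fun i => mprk_pi M F l' (dt i, yn i, Z i)) yn
  (fun i => row l' (Y i))).
- by case: hF.
- by move=> j; exact: isO_cst.
- move=> j; apply: cvg_mxP => a c; rewrite (ord1 a).
  rewrite (_ : (fun i => _) = fun i => Z i j c); last first.
    by apply/funext => i; rewrite mxE.
  have -> : x0 0 c = (\matrix_(_ < s) x0) j c by rewrite mxE.
  exact: cvg_coord.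
- move=> {nu}nu; apply: (@isO_inv _ _ _ _ _ (mprk_pi M F l' base_point 0 nu / 2)).
    by rewrite divr_gt0 // pi_pos.
  have /cvgrPdist_le : mprk_pi M F l' (dt i, yn i, Z i) 0 nu @[i --> Fi] -->
      mprk_pi M F l' base_point 0 nu by exact: cvg_coord.
  have p0 := pi_pos 0 nu.
  move=> /(_ (mprk_pi M F l' base_point 0 nu / 2)); rewrite divr_gt0 // => /(_ isT).
  by apply: filterS => i; rewrite ler_norml => /andP[_]; lra.
- exact: yn_x0.
- apply: filterS stages => i /(_ l').
  rewrite (@mprk_pi_earlier _ _ _ _ hM _ _ l' _ _ _ (Z i) hF); last first.
    by move=> j jl; apply/rowP => c; rewrite !mxE jl.
  apply: patankar_congr => j; have [jl|jl] := ltnP j l'.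
    by right; apply/rowP => c; rewrite !mxE jl.
  by left; rewrite (mprk_explicit hM).
Qed.

Lemma stage_row_cvg l : (row l (Y i)) @[i --> Fi] --> x0.
Proof.
apply: cvg_mxP => a c; rewrite (ord1 a).
rewrite (_ : (fun i => _) = fun i => Y i l c).
  by apply: (Odt_dist_cvg dt_to0 (stage_increment l c)); exact: cvg_coord.
by apply/funext => i; rewrite mxE.
Qed.

Lemma stages_cvg : Y @ Fi --> \matrix_(_ < s) x0.
Proof.
apply: cvg_mxP => a c; rewrite mxE.
by apply: (Odt_dist_cvg dt_to0 (stage_increment a c)); exact: cvg_coord.
Qed.

Definition sigma0 (y : 'rV[R]_N) : 'rV[R]_N :=
  mprk_sigma M F (0, y, \matrix_(_ < s) y).

(** Lipschitz continuity of sigma, applied between the step and the limit point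
    with the same y^n: their distance is O(dt). *)
Lemma sigma_increment nu :
  Odt Fi dt 1 (fun i => mprk_sigma M F (dt i, yn i, Y i) 0 nu - sigma0 (yn i) 0 nu).
Proof.
have [qp qD] := near_pwd_dom stages_cvg.
have oy := yn_x0 (orthant_nbhs ox0).
have rD : \forall i \near Fi, pwd_dom R s N ((0 : R^o), yn i, \matrix_(_ < s) yn i).
  near=> i; have oyi : orthant R 1 N (yn i) by near: i; exact: oy.
  by split=> //=; exact: orthant_const.
have rp : ((0 : R^o), yn i, \matrix_(_ < s) yn i) @[i --> Fi] --> base_point.
  have h : (((0 : R^o), yn i) @[i --> Fi] --> ((0 : R^o), x0)).
    exact: (@cvg_pair _ _ _ Fi (nbhs (0 : R^o)) (nbhs x0)
      _ _ _ _ _ (cvg_cst _) yn_x0).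
  exact: (@cvg_pair _ _ _ Fi (nbhs (0 : R^o, x0)) (nbhs (\matrix_(_ < s) x0))
    _ _ _ _ _ h const_stages_cvg).
have pairp : ((dt i : R^o, yn i, Y i), ((0 : R^o), yn i, \matrix_(_ < s) yn i))
    @[i --> Fi] --> (base_point, base_point).
  exact: (@cvg_pair _ _ _ Fi (nbhs base_point) (nbhs base_point) _ _ _ _ _ qp rp).
have pairD : \forall i \near Fi, (pwd_dom R s N `*` pwd_dom R s N)
    ((dt i : R^o, yn i, Y i), ((0 : R^o), yn i, \matrix_(_ < s) yn i)).
  by apply: filterS2 qD rD.
have [C C0 hC] := pinfty_ex_gt0
  (@mprk_sigma_lipschitz _ _ _ _ hM _ _ hF (base_point, base_point)
    (conj base_point_dom base_point_dom)).
have hC' : \forall i \near Fi,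
    `|mprk_sigma M F (dt i, yn i, Y i) - sigma0 (yn i)| <=
    C * `|(dt i : R^o, yn i, Y i) - ((0 : R^o), yn i, \matrix_(_ < s) yn i)|.
  exact: (@cvg_within_dom _ Fi FF _ _ _ _ pairp pairD _ hC).
have Yc : isO Fi (fun i => dt i ^+ 1) (fun i => `|Y i - \matrix_(_ < s) yn i|).
  apply: isO_norm => a c.
  by apply: Odt_eq (stage_increment a c) => i; rewrite !mxE.
have bound : Odt Fi dt 1 (fun i => C * (`|dt i| + `|Y i - \matrix_(_ < s) yn i|)).
  rewrite -[1%N]/(0 + 1)%N; apply: OdtM; first exact: Odt_cst.
  apply: OdtD Yc; have : Odt Fi dt 1 dt by exact: Odt_dt.
  apply: isO_le.
  by apply: nearW => i; rewrite normr_id.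
apply: isO_le bound; apply: filterS hC' => i h.
have := coord_le_norm (mprk_sigma M F (dt i, yn i, Y i) - sigma0 (yn i)) 0 nu.
rewrite !mxE => /le_trans; apply; apply: le_trans h _.
rewrite ger0_norm; last by rewrite mulr_ge0 ?(ltW C0) // addr_ge0.
rewrite ler_wpM2l ?(ltW C0) // prod_normE /= prod_normE /= subr0 subrr normr0.
by rewrite !comparable_ge_max ?real_comparable ?num_real // lerDl lerDr
  addr_ge0 // !normr_ge0.
Unshelve. all: by end_near.
Qed.
End Stages.

(** * Local bounds for the right-hand side *)

Section RhsControl.
Context (R : realType) (N : nat).

Lemma prod_nbhs_closed_ball (x0 : 'rV[R]_N) (P : 'rV[R]_N * 'rV[R]_N -> Prop) :
  (\forall p \near filter_prod (nbhs x0) (nbhs x0), P p) ->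
  exists2 r : R, 0 < r & forall x y : 'rV[R]_N,
    `|x - x0| <= r -> `|y - x0| <= r -> P (x, y).
Proof.
move=> [[A B] /= [/nbhs_closed_ball[a a0 hA] /nbhs_closed_ball[b b0 hB]] AB].
exists (Num.min a b) => [|x y hx hy]; first by rewrite lt_min a0 b0.
apply: AB; split => /=.
  by apply: hA; apply: le_trans hx _; rewrite ge_min lexx.
by apply: hB; apply: le_trans hy _; rewrite ge_min lexx orbT.
Qed.

Lemma Ck2_isO (I : Type) (Fi : set_system I) {FF : Filter Fi} k
    (x0 : 'rV[R]_N) (f : 'rV[R]_N -> R^o) (Z W : I -> 'rV[R]_N) :
  Ck k.+2 (orthant R 1 N) f -> orthant R 1 N x0 ->
  Z @ Fi --> x0 -> W @ Fi --> x0 ->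
  isO Fi (fun i => `|Z i - W i| ^+ 2) (fun i => f (Z i) - f (W i) -
    \sum_j 'D_(delta_mx 0 j) f (W i) * (Z i 0 j - W i 0 j)).
Proof.
move=> fk ox0 Zx0 Wx0; have [C [_ /exists_small[r r0 h]]] := Ck2_quadratic fk ox0.
exists C; move/cvgrPdist_le : Zx0 => /(_ _ r0); move/cvgrPdist_le : Wx0 => /(_ _ r0).
apply: filterS2 => i hW hZ; rewrite normrX normr_id.
by apply: h; rewrite distrC.
Qed.

Context (F : pds R N).

(** Written through the partial derivatives of the terms, as smoothness is
    assumed of these. *)
Definition rhs_jacobian (y : 'rV[R]_N) (l i : 'I_N) : R :=
  \sum_nu ('D_(delta_mx 0 i) (fun y => prod_term F y l nu : R^o) y -
           'D_(delta_mx 0 i) (fun y => dest_term F y l nu : R^o) y).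

(** One radius and one constant for everything that the estimates of solutions
    use. *)
Record rhs_control (x0 : 'rV[R]_N) (r C : R) : Prop := RhsControl {
  rhs_bounded : forall x l, `|x - x0| <= r -> `|pds_rhs F x 0 l| <= C;
  rhs_lipschitz : forall x y l, `|x - x0| <= r -> `|y - x0| <= r ->
    `|pds_rhs F x 0 l - pds_rhs F y 0 l| <= C * `|x - y|;
  rhs_quadratic : forall x y l, `|x - x0| <= r -> `|y - x0| <= r ->
    `|pds_rhs F x 0 l - pds_rhs F y 0 l -
      \sum_i rhs_jacobian y l i * (x 0 i - y 0 i)| <= C * `|x - y| ^+ 2;
  rhs_jacobian_bounded : forall y l i, `|y - x0| <= r ->
    `|rhs_jacobian y l i| <= C }.

Lemma rhs_control_exists k (x0 : 'rV[R]_N) : Ck_pds k.+2 F -> orthant R 1 N x0 ->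
  exists r C : R, [/\ 0 < r, 0 < C & rhs_control x0 r C].
Proof.
move=> Fk ox0; pose FP := filter_prod (nbhs x0) (nbhs x0).
have c1 : (fun p : 'rV[R]_N * 'rV[R]_N => p.1) @ FP --> x0 by exact: cvg_fst.
have c2 : (fun p : 'rV[R]_N * 'rV[R]_N => p.2) @ FP --> x0 by exact: cvg_snd.
have lip l : isO FP (fun p => `|p.1 - p.2|)
    (fun p => pds_rhs F p.1 0 l - pds_rhs F p.2 0 l).
  apply: (@isO_eq _ _ _ _ _ (fun p => \sum_nu
    ((prod_term F p.1 l nu - prod_term F p.2 l nu) -
     (dest_term F p.1 l nu - dest_term F p.2 l nu)))).
    by move=> p; rewrite !mxE -sumrB; apply: eq_bigr => nu _; ring.
  apply: isO_sum => nu _; have [Fp Fd] := Fk l nu.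
  by apply: isOB; [exact: (Ck1_isO ox0 Fp)|exact: (Ck1_isO ox0 Fd)].
have bnd l : isO FP (fun=> 1) (fun p => pds_rhs F p.1 0 l).
  apply: (@isO_eq _ _ _ _ _ (fun p => \sum_nu
    (prod_term F p.1 l nu - dest_term F p.1 l nu))).
    by move=> p; rewrite !mxE.
  apply: isO_sum => nu _; have [Fp Fd] := Fk l nu.
  by apply: isOB; [exact: (Ck_bounded ox0 Fp)|exact: (Ck_bounded ox0 Fd)].
have jac l i : isO FP (fun=> 1) (fun p => rhs_jacobian p.2 l i).
  apply: isO_sum => nu _; have [Fp Fd] := Fk l nu.
  exact: (isOB (Ck_bounded ox0 (Ck_derive (delta_mx 0 i) Fp) c2)
               (Ck_bounded ox0 (Ck_derive (delta_mx 0 i) Fd) c2)).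
have quad l : isO FP (fun p => `|p.1 - p.2| ^+ 2)
    (fun p => pds_rhs F p.1 0 l - pds_rhs F p.2 0 l -
      \sum_i rhs_jacobian p.2 l i * (p.1 0 i - p.2 0 i)).
  pose T (f : 'rV[R]_N -> R^o) (p : 'rV[R]_N * 'rV[R]_N) : R := f p.1 - f p.2 -
    \sum_j 'D_(delta_mx 0 j) f p.2 * (p.1 0 j - p.2 0 j).
  apply: (@isO_eq _ _ _ _ _ (fun p => \sum_nu
    (T (fun y => prod_term F y l nu) p - T (fun y => dest_term F y l nu) p))).
    move=> p; rewrite !mxE -sumrB.
    under [X in _ = _ - X]eq_bigr do rewrite mulr_suml.
    rewrite exchange_big /= -sumrB; apply: eq_bigr => nu _; rewrite /T.
    under [X in _ = _ - X]eq_bigr do rewrite mulrBl.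
    by rewrite sumrB; ring.
  apply: isO_sum => nu _; have [Fp Fd] := Fk l nu.
  by apply: isOB; [exact: (Ck2_isO Fp ox0)|exact: (Ck2_isO Fd ox0)].
have uni (g : 'rV[R]_N * 'rV[R]_N -> R) (J : finType)
      (u : J -> 'rV[R]_N * 'rV[R]_N -> R) :
    (forall j, isO FP g (u j)) -> exists r C : R, [/\ 0 < r, 0 <= C &
      forall j x y, `|x - x0| <= r -> `|y - x0| <= r ->
        `|u j (x, y)| <= C * `|g (x, y)|].
  move=> hu; have : isO FP g (fun p => \sum_j `|u j p|).
    apply: isO_sum => j _; apply: isO_le (hu j).
    by apply: nearW => p; rewrite normr_id.
  move=> /isO_pos[C C0 /prod_nbhs_closed_ball[r r0 hr]].
  exists r, C; split => // [|j x y hx hy]; first exact: ltW.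
  apply: le_trans (hr x y hx hy); rewrite [leRHS]ger0_norm ?sumr_ge0 //.
  by rewrite (bigD1 j) //= lerDl sumr_ge0.
have [r1 [C1 [r10 C10 h1]]] := uni _ _ _ lip.
have [r2 [C2 [r20 C20 h2]]] := uni _ _ _ bnd.
have [r3 [C3 [r30 C30 h3]]] := uni _ _ _ quad.
have [r4 [C4 [r40 C40 h4]]] := uni _ ('I_N * 'I_N)%type
  (fun j p => rhs_jacobian p.2 j.1 j.2) (fun j => jac j.1 j.2).
pose r := Num.min (Num.min r1 r2) (Num.min r3 r4).
have [rr1 rr2 rr3 rr4] : [/\ r <= r1, r <= r2, r <= r3 & r <= r4].
  by rewrite /r !ge_min !lexx ?orbT.
pose C := 1 + C1 + C2 + C3 + C4.
exists r, C; split; [by rewrite !lt_min r10 r20 r30 r40|by rewrite /C; lra|split].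
- move=> x l hx; have := h2 l x x (le_trans hx rr2) (le_trans hx rr2).
  by rewrite normr1 mulr1 => /le_trans; apply; rewrite /C; lra.
- move=> x y l hx hy; have := h1 l x y (le_trans hx rr1) (le_trans hy rr1).
  by rewrite normr_id => /le_trans; apply; rewrite ler_wpM2r // /C; lra.
- move=> x y l hx hy; have := h3 l x y (le_trans hx rr3) (le_trans hy rr3).
  rewrite /= normrX normr_id => /le_trans; apply.
  by rewrite ler_wpM2r ?exprn_ge0 // /C; lra.
- move=> y l i hy; have := h4 (l, i) y y (le_trans hy rr4) (le_trans hy rr4).
  by rewrite normr1 mulr1 => /le_trans; apply; rewrite /C; lra.
Qed.

End RhsControl.

(** * Solutions over one step *)

Section Solutions.
Context (R : realType) (N : nat).
Implicit Types (g : R -> 'rV[R]_N -> 'rV[R]_N) (z : R -> 'rV[R]_N).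

Lemma increment_bound (u du : R -> R) (b B : R) : 0 <= b ->
  {within `[0, b], continuous u} ->
  (forall t, 0 < t < b -> is_derive t 1 u (du t)) ->
  (forall t, 0 < t < b -> `|du t| <= B) -> `|u b - u 0| <= B * b.
Proof.
rewrite le_eqVlt => /predU1P[<- _ _ _|b0 uc ud dub].
  by rewrite subrr normr0 mulr0.
have ud' t : t \in `]0, b[ -> is_derive t 1 u (du t).
  by rewrite in_itv; exact: ud.
have [c cb ->] := MVT b0 ud' uc.
by rewrite subr0 normrM (gtr0_norm b0) ler_wpM2r ?(ltW b0) // dub // -in_itv.
Qed.

Lemma solves_coord g a b z l : solves g a b z ->
  {within `[a, b], continuous (fun t => z t 0 l)} /\
  (forall t, a < t < b -> is_derive t 1 (fun t => z t 0 l) (g t (z t) 0 l)).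
Proof.
move=> [zc zd]; split.
  move=> t; apply: (@continuous_comp (subspace `[a, b]) _ _ z (fun M => M 0 l) t).
    exact: zc.
  exact: coord_continuous.
move=> t tab; have [dz Dz] := zd t tab.
apply: DeriveDef; first exact: (derivable_mxP (z : R^o -> 'rV[R]_N) t 1).1 dz 0 l.
by have := derive_mx dz; rewrite Dz => ->; rewrite mxE.
Qed.

Lemma solves_sub g a b c z : c <= b -> solves g a b z -> solves g a c z.
Proof.
move=> cb [zc zd]; split.
  apply: continuous_subspaceW zc => t; rewrite /= !in_itv /= => /andP[-> tc].
  exact: le_trans tc cb.
by move=> t /andP[at_ tc]; apply: zd; rewrite at_ (lt_le_trans tc cb).
Qed.

Lemma solves_shift (f : 'rV[R]_N -> 'rV[R]_N) (a h T : R) z : 0 <= a -> a + h <= T ->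
  solves (fun=> f) 0 T z -> solves (fun=> f) 0 h (fun t => z (a + t)).
Proof.
move=> a0 ahT [zc zd]; split.
  apply/subspace_continuousP => t th.
  have dom s : `[0, h]%classic s -> `[0, T]%classic (a + s).
    by rewrite /= !in_itv /= => /andP[s0 sh]; lra.
  have /subspace_continuousP /(_ _ (dom _ th)) := zc.
  apply: cvg_comp; apply: cvg_within_dom.
    apply: cvg_within_filter; apply: cvgD; [exact: cvg_cst|exact: cvg_id].
  by near=> s; apply: dom; near: s; exact: withinT.
move=> t th; have [|dz Dz] := zd (a + t); first lra.
have E : (fun s : R => s^-1 *: (((fun t : R => z (a + t)) \o shift t) (s *: (1 : R))
    - z (a + t))) =
  (fun s : R => s^-1 *: (((z : R^o -> _) \o shift (a + t)) (s *: (1 : R)) - z (a + t))).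
  by apply/funext => s /=; rewrite addrCA.
apply: DeriveDef; first by rewrite /derivable E.
by move: Dz; rewrite /derive -E.
Unshelve. all: by end_near.
Qed.

End Solutions.

Section LocalFlow.
Context (R : realType) (N : nat) (F : pds R N) (x0 : 'rV[R]_N) (r C : R).
Hypotheses (r0 : 0 < r) (C0 : 0 < C) (hc : rhs_control F x0 r C).
Implicit Types z : R -> 'rV[R]_N.

(** A solution cannot leave the ball of radius r / 2 around its initial value
    before time r / (2 C): at the first exit time the mean value theorem
    would give a displacement smaller than r / 2. *)
Lemma solution_increment h z : C * h < r / 2 -> `|z 0 - x0| <= r / 2 ->
  pds_solves F h z -> forall t, 0 <= t <= h ->
  `|z t - x0| <= r /\ `|z t - z 0| <= C * t.
Proof.
move=> hr z0 zs.
have [t0|h0] := ltP h 0; first by move=> t /andP[]; lra.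
have incr b : 0 <= b <= h -> (forall t, 0 < t < b -> `|z t - z 0| < r / 2) ->
    `|z b - z 0| <= C * b.
  move=> /andP[b0 bh] small; apply/mx_norm_leP => [|i l].
    by rewrite mulr_ge0 // ltW.
  rewrite (ord1 i) !mxE.
  have [zlc zld] := solves_coord l (solves_sub bh zs).
  apply: (increment_bound b0 zlc zld) => t tb; apply: (rhs_bounded hc).
  by have := small t tb; have := ler_distD (z 0) (z t) x0; lra.
have small t : 0 <= t <= h -> `|z t - z 0| < r / 2.
  pose A := [set s | 0 <= s <= h /\ r / 2 <= `|z s - z 0|].
  move=> th; rewrite ltNge; apply/negP => zt.
  have At : A t by [].
  have lbA : has_lbound A by exists 0 => s [/andP[]].
  have iA : has_inf A by split; [exists t|].
  (* The first exit time; by continuity it belongs to A. *)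
  pose tau := inf A.
  have tau0 : 0 <= tau by apply: lb_le_inf; [exists t|move=> s [/andP[]]].
  have tauh : tau <= h by apply: le_trans (ge_inf lbA At) _; case/andP: th.
  have tauI : 0 <= tau <= h by rewrite tau0 tauh.
  have before s : 0 < s < tau -> `|z s - z 0| < r / 2.
    move=> /andP[s0 st]; rewrite ltNge; apply/negP => zs'.
    have : A s by split=> //; rewrite (ltW s0) (ltW (lt_le_trans st tauh)).
    by move=> /(ge_inf lbA); rewrite leNgt st.
  have := incr _ tauI before => ztau.
  have ztau' : `|z tau - z 0| < r / 2.
    by apply: le_lt_trans ztau (le_lt_trans _ hr); rewrite ler_pM2l.
  have [zc _] := zs.
  have /subspace_continuousP /(_ tau) := zc; rewrite /= in_itv /= => /(_ tauI).
  pose d := r / 2 - `|z tau - z 0|.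
  have d0 : 0 < d by rewrite /d subr_gt0.
  move=> /cvgrPdist_lt /(_ d d0) nb.
  have /nbhs_ballP[e /= e0 he] :
      nbhs tau (fun s => `[0, h]%classic s -> `|z tau - z s| < d) by exact: nb.
  have [s As] := inf_adherent e0 iA; rewrite -/tau => se.
  have taus : tau <= s by exact: ge_inf.
  have [sI zs'] := As.
  have := he s; rewrite -ball_normE /= => /(_ _).
  rewrite ltr_norml in_itv /=.
  have -> : (- e < tau - s < e) by lra.
  move=> /(_ isT sI) hd.
  have := ler_distD (z tau) (z s) (z 0); rewrite (distrC (z s) (z tau)).
  by move: hd zs'; rewrite /d; lra.
move=> t th; have ht : `|z t - z 0| <= C * t.
  apply: incr => // s st; apply: small; lra.
split=> //; have := small t th; have := ler_distD (z 0) (z t) x0; lra.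
Qed.


Definition second_derivative (y : 'rV[R]_N) (l : 'I_N) : R :=
  \sum_i rhs_jacobian F y l i * pds_rhs F y 0 i.

Lemma cvg_poly2 (a b t : R) : (fun s : R => s * a + s ^+ 2 * b) s @[s --> t] -->
  t * a + t ^+ 2 * b.
Proof.
apply: cvgD; first by apply: cvgMl; exact: cvg_id.
by apply: cvgMl; apply: exprn_continuous.
Qed.

Lemma is_derive_poly2 (a b t : R) :
  is_derive t 1 (fun s : R => s * a + s ^+ 2 * b) (a + 2 * t * b).
Proof.
have h1 : is_derive t (1 : R) (fun s : R => a *: s) (a *: (1 : R)).
  exact: is_deriveZ.
have h2 : is_derive t (1 : R) (fun s : R => b *: s ^+ 2)
    (b *: ((2%:R * t ^+ 1) *: (1 : R))).
  apply: is_deriveZ; exact: (@is_deriveX _ _ id 2 t 1 1).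
have := is_deriveD h1 h2.
have -> : (fun s : R => a *: s) + (fun s : R => b *: s ^+ 2) =
    (fun s : R => s * a + s ^+ 2 * b).
  apply/funext => s; change (a * s + b * s ^+ 2 = s * a + s ^+ 2 * b); ring.
have -> // : a *: (1 : R) + b *: ((2%:R * t ^+ 1) *: (1 : R)) = a + 2 * t * b.
by rewrite /GRing.scale /= expr1; ring.
Qed.

Lemma taylor_remainder h z (a b B : R) l : 0 <= h -> pds_solves F h z ->
  (forall t, 0 < t < h -> `|pds_rhs F (z t) 0 l - (a + 2 * t * b)| <= B) ->
  `|z h 0 l - z 0 0 l - (h * a + h ^+ 2 * b)| <= B * h.
Proof.
move=> h0 zs hB; have [zlc zld] := solves_coord l zs.
have := @increment_bound R (fun t => z t 0 l - (t * a + t ^+ 2 * b))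
  (fun t => pds_rhs F (z t) 0 l - (a + 2 * t * b)) h B h0.
rewrite mul0r expr0n /= mul0r addr0 subr0 addrAC; apply => //.
  apply/subspace_continuousP => t th; apply: cvgB.
    by move/subspace_continuousP : zlc; exact.
  apply: cvg_within_filter; exact: cvg_poly2.
move=> t th; apply: is_deriveB; last exact: is_derive_poly2.
exact: zld.
Qed.

(** The first-order expansion, inserted in that of the right-hand side, gives z'
    up to O(t^2), and this integrates to the second-order expansion.  The
    constants only depend on the ball, hence are uniform in z 0. *)
Lemma solution_taylor : exists2 K, 0 < K & forall h z,
  0 <= h -> C * h < r / 2 -> `|z 0 - x0| <= r / 2 -> pds_solves F h z -> forall l,
  `|z h 0 l - z 0 0 l - h * pds_rhs F (z 0) 0 l| <= K * h ^+ 2 /\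
  `|z h 0 l - z 0 0 l - (h * pds_rhs F (z 0) 0 l +
       h ^+ 2 * (second_derivative (z 0) l / 2))| <= K * h ^+ 3.
Proof.
(* The first summand bounds the quadratic remainder of the right-hand side along
   z, the second one the Jacobian applied to the first-order error of z. *)
pose K := C * C ^+ 2 + N%:R * (C * C ^+ 2).
have CC : 0 < C ^+ 2 by rewrite exprn_gt0.
have CCC : 0 < C * C ^+ 2 by rewrite mulr_gt0.
have NC : 0 <= N%:R * (C * C ^+ 2) by rewrite mulr_ge0 // ltW.
have K0 : 0 <= K by rewrite /K addr_ge0 // ltW.
exists (C ^+ 2 + K) => [|h z h0 hr z0 zs l]; first by lra.
have stay := solution_increment hr z0 zs.
have rr : r / 2 <= r by have := r0; lra.
have z0r := le_trans z0 rr.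
have first_order t l' : 0 <= t <= h ->
    `|z t 0 l' - z 0 0 l' - t * pds_rhs F (z 0) 0 l'| <= C ^+ 2 * t ^+ 2.
  move=> /andP[t0 th].
  have := @taylor_remainder t z (pds_rhs F (z 0) 0 l') 0 (C ^+ 2 * t) l' t0
    (solves_sub th zs).
  rewrite mulr0 addr0 (_ : C ^+ 2 * t * t = C ^+ 2 * t ^+ 2); last by ring.
  apply => s /andP[s0 st].
  have sh : 0 <= s <= h by lra.
  have [zsr zsi] := stay s sh.
  rewrite mulr0 addr0 (le_trans (rhs_lipschitz hc l' zsr z0r)) // expr2 -mulrA.
  rewrite ler_pM2l // (le_trans zsi) // ler_pM2l //; exact: ltW.
have hh : 0 <= h <= h by rewrite h0 lexx.
split.
  by apply: le_trans (first_order h l hh) _; rewrite ler_wpM2r ?sqr_ge0 //; lra.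
apply: (@le_trans _ _ ((K * h ^+ 2) * h)); last first.
  have -> : (C ^+ 2 + K) * h ^+ 3 = (C ^+ 2 + K) * h ^+ 2 * h by ring.
  by rewrite ler_wpM2r // ler_wpM2r ?sqr_ge0 //; lra.
apply: taylor_remainder => // t /andP[t0 th].
have tI : 0 <= t <= h by lra.
have [ztr zti] := stay t tI.
have q := rhs_quadratic hc l ztr z0r.
have q2 : C * `|z t - z 0| ^+ 2 <= C * C ^+ 2 * h ^+ 2.
  rewrite -mulrA ler_pM2l // -exprMn ler_pXn2r ?nnegrE ?mulr_ge0 ?(ltW C0) //.
  by apply: le_trans zti _; rewrite ler_pM2l // ltW.
have s2 : `|\sum_i rhs_jacobian F (z 0) l i *
    (z t 0 i - z 0 0 i - t * pds_rhs F (z 0) 0 i)| <= N%:R * (C * C ^+ 2) * h ^+ 2.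
  apply: le_trans (ler_norm_sum _ _ _) _.
  rewrite -mulrA mulr_natl -[N in leRHS]card_ord -sumr_const.
  apply: ler_sum => i _; rewrite normrM -mulrA ler_pM //.
    exact: rhs_jacobian_bounded hc _ _ _ z0r.
  apply: le_trans (first_order t i tI) _; rewrite ler_pM2l //.
  by rewrite ler_pXn2r ?nnegrE // ltW.
rewrite (_ : _ - _ = (pds_rhs F (z t) 0 l - pds_rhs F (z 0) 0 l -
     \sum_i rhs_jacobian F (z 0) l i * (z t 0 i - z 0 0 i)) +
   \sum_i rhs_jacobian F (z 0) l i *
    (z t 0 i - z 0 0 i - t * pds_rhs F (z 0) 0 i)).
  rewrite (le_trans (ler_normD _ _)) // /K mulrDl lerD //.
  exact: le_trans q q2.
have -> : 2 * t * (second_derivative (z 0) l / 2) = t * second_derivative (z 0) l.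
  by field.
rewrite /second_derivative mulr_sumr.
rewrite -[RHS]addrA -sumrN -big_split /= opprD addrA; congr (_ + _).
by rewrite -sumrN; apply: eq_bigr => i _; ring.
Qed.

(** Any quadratic polynomial in t is recovered from its value and slope at 0
    and its value at h; the Taylor expansion makes this hold for a solution up
    to O(h^3). *)
Lemma solution_hermite : exists2 K, 0 < K & forall h z th,
  0 <= h -> C * h < r / 2 -> `|z 0 - x0| <= r / 2 -> pds_solves F h z ->
  0 <= th <= 1 -> forall l,
  `|z (th * h) 0 l - z 0 0 l - (th - th ^+ 2) * (h * pds_rhs F (z 0) 0 l)
    - th ^+ 2 * (z h 0 l - z 0 0 l)| <= K * h ^+ 3.
Proof.
have [K K0 hK] := solution_taylor; exists (2 * K) => [|h z th h0 hr z0 zs].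
  by rewrite mulr_gt0.
move=> /andP[th0 th1] l.
have thh0 : 0 <= th * h by rewrite mulr_ge0.
have thh : th * h <= h by rewrite ler_piMl.
have hr' : C * (th * h) < r / 2 by apply: le_lt_trans hr; rewrite ler_pM2l.
have [_ e1] := hK _ _ h0 hr z0 zs l.
have [_ e2] := hK _ _ thh0 hr' z0 (solves_sub thh zs) l.
set a := pds_rhs F (z 0) 0 l in e1 e2 *.
set v := second_derivative (z 0) l in e1 e2 *.
rewrite (_ : _ - _ - _ - _ =
  (z (th * h) 0 l - z 0 0 l - (th * h * a + (th * h) ^+ 2 * (v / 2)))
  - th ^+ 2 * (z h 0 l - z 0 0 l - (h * a + h ^+ 2 * (v / 2)))); last by ring.
have -> : 2 * K * h ^+ 3 = K * h ^+ 3 + K * h ^+ 3 by ring.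
rewrite (le_trans (ler_normB _ _)) // lerD //.
  apply: le_trans e2 _; rewrite ler_pM2l // ler_pXn2r // nnegrE //.
rewrite normrM; apply: le_trans e1; rewrite ler_piMl //.
by rewrite ger0_norm ?exprn_ile1 // sqr_ge0.
Qed.

(** The largest distance S between the two solutions on the step satisfies
    S <= S(0) + C h S, which replaces a Gronwall argument. *)
Lemma flow_stability h z1 z2 : 0 <= h -> C * h < r / 2 -> C * h <= 1 / 2 ->
  `|z1 0 - x0| <= r / 2 -> `|z2 0 - x0| <= r / 2 ->
  pds_solves F h z1 -> pds_solves F h z2 ->
  `|z1 h - z2 h| <= (1 + 2 * C * h) * `|z1 0 - z2 0|.
Proof.
move=> h0 hr h2 z10 z20 s1 s2.
have st1 := solution_increment hr z10 s1.
have st2 := solution_increment hr z20 s2.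
have dc : {within `[0, h], continuous (fun t => `|z1 t - z2 t|)}.
  have [c1 _] := s1; have [c2 _] := s2.
  apply/subspace_continuousP => t th; apply: cvg_norm; apply: cvgB.
    by move/subspace_continuousP : c1; exact.
  by move/subspace_continuousP : c2; exact.
have [t tI tmax] := EVT_max h0 dc.
have hI : h \in `[0, h] by rewrite in_itv /= h0 lexx.
apply: le_trans (tmax _ hI) _.
move: tI; rewrite in_itv /= => /andP[t0 th].
set S := `|z1 t - z2 t| in tmax *; set D := `|z1 0 - z2 0|.
have S0 : 0 <= S by rewrite /S.
have D0 : 0 <= D by rewrite /D.
have hS : S <= D + C * S * h.
  apply/mx_norm_leP => [|i l]; first by rewrite addr_ge0 ?mulr_ge0 ?(ltW C0).
  rewrite (ord1 i) !mxE.
  have [c1 d1] := solves_coord l (solves_sub th s1).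
  have [c2 d2] := solves_coord l (solves_sub th s2).
  have := @increment_bound R (fun t => z1 t 0 l - z2 t 0 l)
    (fun t => pds_rhs F (z1 t) 0 l - pds_rhs F (z2 t) 0 l) t (C * S) t0.
  move=> inc; have {}inc : `|z1 t 0 l - z2 t 0 l - (z1 0 0 l - z2 0 0 l)| <= C * S * t.
    apply: inc.
    - apply/subspace_continuousP => s sI; apply: cvgB.
        by move/subspace_continuousP : c1; exact.
      by move/subspace_continuousP : c2; exact.
    - by move=> s sI; apply: is_deriveB; [exact: d1|exact: d2].
    - move=> s /andP[s0 st]; have sI : 0 <= s <= h by lra.
      have [zr1 _] := st1 s sI; have [zr2 _] := st2 s sI.
      apply: le_trans (rhs_lipschitz hc l zr1 zr2) _; rewrite ler_pM2l //.
      by apply: tmax; rewrite in_itv.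
  have d0 := coord_le_norm (z1 0 - z2 0) 0 l; rewrite !mxE -/D in d0.
  have : C * S * t <= C * S * h by rewrite ler_wpM2l // mulr_ge0 // ltW.
  have := ler_distD (z1 0 0 l - z2 0 0 l) (z1 t 0 l - z2 t 0 l) 0.
  rewrite !subr0; lra.
have x0' : 0 <= C * h by rewrite mulr_ge0 // ltW.
have {}hS : S <= D + S * (C * h) by rewrite mulrA [S * C]mulrC.
rewrite -mulrA; move: x0' h2 hS; move: (C * h) => x x0' h2 hS.
have q : 0 <= S * (x * (1 - 2 * x)) by rewrite !mulr_ge0 //; lra.
have q' : 0 <= (1 + 2 * x) * (D + S * x - S) by rewrite mulr_ge0 //; lra.
lra.
Qed.

End LocalFlow.

(** * Smooth test functions and the sum of the weights *)

Section CkExamples.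
Context (R : realType).

Lemma Ck_cst (V W : normedModType R) k (U : set V) (c : W) : Ck k U (fun=> c).
Proof.
elim: k c => [|k ih] c; first by move=> x _; exact: cst_continuous.
split; first by move=> x _; exact: cst_continuous.
split; first by move=> x v _; exact: derivable_cst.
move=> v; have -> : 'D_v (fun=> c) = (fun=> 0) :> (V -> W).
  by apply/funext => x; rewrite derive_cst.
exact: ih.
Qed.

Lemma Ck_coord n k (U : set 'rV[R]_n) i : Ck k U (fun y : 'rV[R]_n => y 0 i : R^o).
Proof.
case: k => [|k]; first by move=> x _; exact: coord_continuous.
have dv (x v : 'rV[R]_n) : derivable id x v by exact: derivable_id.
split; first by move=> x _; exact: coord_continuous.
split; first by move=> x v _; exact: (derivable_mxP id x v).1.
move=> v; suff -> : 'D_v (fun y : 'rV[R]_n => y 0 i : R^o) = (fun=> v 0 i).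
  exact: Ck_cst.
apply/funext => x; have := derive_mx (dv x v).
by rewrite derive_id => /matrixP/(_ 0 i); rewrite mxE.
Qed.

End CkExamples.


Lemma le_pow_eq0 (R : realType) (a C h : R) n : 0 < h ->
  (forall t, 0 < t <= h -> `|a| <= C * t ^+ n.+1) -> a = 0.
Proof.
move=> h0 bound; apply/eqP; rewrite -normr_le0; apply/ler_addgt0Pl => e e0.
rewrite addr0; have D0 : 0 < `|C| + 1 by rewrite ltr_wpDl.
pose t := Num.min (Num.min h 1) (e / (`|C| + 1)).
have t0 : 0 < t by rewrite !lt_min h0 ltr01 divr_gt0.
have [th t1 te] : [/\ t <= h, t <= 1 & t <= e / (`|C| + 1)].
  by rewrite /t !ge_min !lexx !orbT.
have := bound t; rewrite t0 th => /(_ isT) /le_trans; apply.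
apply: (@le_trans _ _ (`|C| * t)).
  apply: (@le_trans _ _ (`|C| * t ^+ n.+1)).
    by rewrite ler_wpM2r ?ler_norm // exprn_ge0 // ltW.
  by rewrite ler_wpM2l // exprS ler_piMr ?(ltW t0) // exprn_ile1 // ltW.
move: te; rewrite ler_pdivlMr //; apply: le_trans.
by rewrite mulrC ler_wpM2l ?(ltW t0) // lerDl.
Qed.

(** Testing the order condition on y' = 1. *)
Lemma rk_order_sum (R : realType) s p (B : butcher R s) :
  rk_order p.+1 B -> \sum_j bt_b B j = 1.
Proof.
move=> /(_ 1%N (fun _ _ => const_mx 1) (Ck_cst _ _ _) 0 0)[d [h [C [d0 h0 hC]]]].
pose step dt : 'M[R]_(s, 1) := \matrix_(i, _) (dt * \sum_j bt_A B i j).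
apply/eqP; rewrite -subr_eq0; apply/eqP.
apply: (@le_pow_eq0 R _ C h p h0) => dt hdt; have /andP[dt0 _] := hdt.
have sol : solves (fun _ _ => const_mx 1) 0 (0 + dt) (fun t => const_mx t : 'rV[R]_1).
  split.
    apply: continuous_subspaceT => t; apply: cvg_mxP => i j; rewrite mxE.
    rewrite (_ : (fun s => _) = id); first exact: cvg_id.
    by apply/funext => x; rewrite mxE.
  move=> t _.
  have dz : derivable (fun t : R^o => const_mx t : 'rV[R]_1) t 1.
    apply/derivable_mxP => i j; rewrite (_ : (fun x => _) = id).
      exact: derivable_id.
    by apply/funext => x; rewrite mxE.
  apply: DeriveDef => //; rewrite (derive_mx dz); apply/matrixP => i j; rewrite !mxE.
  rewrite (_ : (fun x => _) = id); first by rewrite derive_id.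
  by apply/funext => x; rewrite mxE.
have st : rk_step B (fun _ _ => const_mx 1) 0 dt 0 (step dt)
    (0 + dt *: \sum_j bt_b B j *: const_mx 1).
  split=> // i; apply/rowP => j; rewrite !mxE add0r summxE; congr (_ * _).
  by apply: eq_bigr => l _; rewrite !mxE mulr1.
have z0 : const_mx 0 = 0 :> 'rV[R]_1 by apply/matrixP => i j; rewrite !mxE.
have := hC 0 dt 0 (step dt) _ (fun t => const_mx t).
rewrite !subrr !normr0 => /(_ _ d0 d0 hdt z0 sol st) hh.
have {hh} := le_trans (coord_le_norm _ 0 0) hh.
rewrite !mxE !add0r summxE (eq_bigr (fun j => bt_b B j)); last first.
  by move=> j _; rewrite !mxE mulr1.
rewrite -{2}[dt]mulr1 -mulrBr normrM gtr0_norm // exprS mulrCA.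
by rewrite ler_pM2l.
Qed.

(** * First-order expansion of a Patankar update *)

Section PatankarExpansion.
Context (R : realType) (I : Type) (Fi : set_system I) {FF : Filter Fi}.
Context (N : nat) (x0 : 'rV[R]_N) (ox0 : orthant R 1 N x0).

Lemma orthant_cvg_inv (den : I -> 'rV[R]_N) (d : 'rV[R]_N) : orthant R 1 N d ->
  den @ Fi --> d ->
  (forall l, isO Fi (fun=> 1) (fun i => (den i 0 l)^-1)) /\
  \forall i \near Fi, forall l, den i 0 l != 0.
Proof.
move=> od dend; have /exists_small[r r0 hr] := orthant_ball od.
have near_r : \forall i \near Fi, forall l, r <= den i 0 l.
  move/cvgrPdist_le : dend => /(_ r r0); apply: filterS => i hi l.
  by apply: hr; rewrite distrC.
split=> [l|]; first by apply: (isO_inv r0); apply: filterS near_r => i hi; exact: hi.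
by apply: filterS near_r => i hi l; rewrite gt_eqF // (lt_le_trans r0).
Qed.

Context (F : pds R N) (k : nat) (Fk : Ck_pds k.+1 F).
Variable dt : I -> R.
Hypothesis dt_to0 : dt @ Fi --> (0 : R).

(** To first order in dt an update sees the system only through the
    production-destruction operator at yn, applied to the limit ratios
    yn / den0. *)
Lemma patankar_expansion s (w : I -> 'I_s -> R) (Y : I -> 'M[R]_(s, N))
    (den den0 yn y : I -> 'rV[R]_N) (d : 'rV[R]_N) :
  (forall j, isO Fi (fun=> 1) (fun i => w i j)) ->
  (forall j, row j (Y i) @[i --> Fi] --> x0) ->
  (forall j nu, Odt Fi dt 1 (fun i => Y i j nu - yn i 0 nu)) ->
  yn @ Fi --> x0 -> orthant R 1 N d -> den0 @ Fi --> d ->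
  (forall nu, Odt Fi dt 1 (fun i => den i 0 nu - den0 i 0 nu)) ->
  (\forall i \near Fi, patankar F (dt i) (w i) (Y i) (den i) (yn i) (y i)) ->
  forall l, Odt Fi dt 2 (fun i => y i 0 l - yn i 0 l -
    dt i * ((\sum_j w i j) * flux F (yn i) (fun nu => yn i 0 nu / den0 i 0 nu) l)).
Proof.
move=> wb Yx0 Yyn ynx0 od den0d denden0 pat l.
have dend : den @ Fi --> d.
  apply: cvg_mxP => a c; rewrite (ord1 a).
  by apply: (Odt_dist_cvg dt_to0 (denden0 c)); exact: cvg_coord.
have [denb den_neq0] := orthant_cvg_inv od dend.
have [den0b den0_neq0] := orthant_cvg_inv od den0d.
have incr nu : Odt Fi dt 1 (fun i => y i 0 nu - yn i 0 nu).
  exact: (patankar_increment ox0 Fk dt_to0 wb Yx0 denb ynx0 pat).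
have ynb nu : Odt Fi dt 0 (fun i => yn i 0 nu).
  by apply: Odt0; apply: (@isO_cvg _ _ _ _ _ (x0 0 nu)); exact: cvg_coord.
have {}denb nu : Odt Fi dt 0 (fun i => (den i 0 nu)^-1) by exact: Odt0.
have {}den0b nu : Odt Fi dt 0 (fun i => (den0 i 0 nu)^-1) by exact: Odt0.
pose v i nu := y i 0 nu / den i 0 nu.
pose v0 i nu := yn i 0 nu / den0 i 0 nu.
have dv nu : Odt Fi dt 1 (fun i => v i nu - v0 i nu).
  pose proof (OdtB (OdtM (incr nu) (denb nu))
    (OdtM (denden0 nu) (OdtM (ynb nu) (OdtM (denb nu) (den0b nu))))) as h.
  move: h; rewrite !addn0; apply: Odt_near; apply: filterS2 den_neq0 den0_neq0.
  move=> i h h0; rewrite /v /v0; field.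
  by rewrite h h0.
have vb nu : Odt Fi dt 0 (fun i => v i nu).
  pose proof (OdtD (Odt_weak (m := 0) dt_to0 isT (dv nu))
    (OdtM (ynb nu) (den0b nu))) as h.
  move: h; by apply: Odt_eq => i; rewrite subrK.
have main : Odt Fi dt 1 (fun i => \sum_j w i j *
    (flux F (row j (Y i)) (v i) l - flux F (yn i) (v0 i) l)).
  apply: Odt_sum => j _; rewrite -[1%N]/(0 + 1)%N; apply: OdtM; first exact: Odt0.
  have Yr nu : Odt Fi dt 1 (fun i => row j (Y i) 0 nu - yn i 0 nu).
    by apply: Odt_eq (Yyn j nu) => i; rewrite mxE.
  pose proof (flux_Odt_diff ox0 Fk l (Yx0 j) ynx0 Yr vb) as h1.
  pose proof (flux_isO ox0 Fk l ynx0 dv) as h2.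
  apply: Odt_eq (OdtD h1 h2) => i.
  by rewrite fluxB subrKA.
pose proof (OdtM (Odt_dt dt) main) as h; move: h; apply: Odt_near.
apply: filterS pat => i /patankarP ->.
rewrite (addrC (yn i 0 l)) addrK -mulrBr; congr (_ * _).
by rewrite mulr_suml -sumrB; apply: eq_bigr => j _; rewrite mulrBr.
Qed.

End PatankarExpansion.

(** * A linear test system *)

Section Transfer.
Context (R : realType) (N : nat) (k l : 'I_N) (kl : k != l).

(** Mass moves from component k to component l at rate one.  Solutions and
    Patankar updates are explicit, which makes the system usable as a test. *)
Definition transfer : pds R N := PDS
  (fun y => \matrix_(i, j) if (i == l) && (j == k) then y 0 k else 0)
  (fun y => \matrix_(i, j) if (i == k) && (j == l) then y 0 k else 0).

Definition transfer_dir (i : 'I_N) : R := (i == l)%:R - (i == k)%:R.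

Lemma transfer_flux y v i :
  flux transfer y v i = transfer_dir i * (y 0 k * v k).
Proof.
rewrite /flux sumrB (bigD1 k) //= [X in _ - X](bigD1 l) //= !big1 => [|j jl|j jk].
- rewrite !mxE !eqxx !andbT !addr0 /transfer_dir.
  by case: (eqVneq i k) => [->|_]; case: eqVneq => _ /=; ring.
- by rewrite mxE (negbTE jl) andbF mul0r.
- by rewrite mxE (negbTE jk) andbF mul0r.
Qed.

Lemma transfer_rhs y i : pds_rhs transfer y 0 i = transfer_dir i * y 0 k.
Proof. by rewrite -flux1 transfer_flux mulr1. Qed.

Lemma transfer_dirk : transfer_dir k = -1.
Proof. by rewrite /transfer_dir (negbTE kl) eqxx sub0r. Qed.

Lemma transfer_dir_ge0 i : i != k -> 0 <= transfer_dir i.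
Proof. by move=> /negbTE ik; rewrite /transfer_dir ik subr0. Qed.

Lemma is_derive_scaled_exp (a b s t : R) :
  is_derive t 1 (fun t : R => a + b * expR (s * t)) (b * s * expR (s * t)).
Proof.
have h1 : is_derive t (1 : R) (fun t : R => s *: t) (s *: (1 : R)).
  exact: is_deriveZ.
have h2 : is_derive (s *: t) (1 : R) (expR : R -> R) (expR (s *: t)).
  exact: is_derive_expR.
have h3 := @is_derive1_comp R (expR : R -> R) (fun t : R => s *: t) t _ _ h2 h1.
have h4 := is_deriveD (is_derive_cst a t (1 : R)) (is_deriveZ b h3).
move: h4; rewrite add0r => h4.
apply: (is_derive_eq h4).
by change (b * (expR (s * t) * (s * 1)) = b * s * expR (s * t)); ring.
Qed.

Lemma cvg_scaled_exp (a b s t : R) :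
  (a + b * expR (s * u)) @[u --> t] --> a + b * expR (s * t).
Proof.
apply: cvgD; first exact: cvg_cst.
apply: cvgMr; apply: (cvg_comp (fun u : R => s * u) expR); last exact: continuous_expR.
by apply: cvgMr; exact: cvg_id.
Qed.

Lemma solves_coordP (g : R -> 'rV[R]_N -> 'rV[R]_N) (a b : R) (z : R -> 'rV[R]_N) :
  (forall i (t : R), z u 0 i @[u --> t] --> z t 0 i) ->
  (forall i (t : R), is_derive t 1 (fun t => z t 0 i) (g t (z t) 0 i)) ->
  solves g a b z.
Proof.
move=> zc zd; split.
  apply: continuous_subspaceT => t; apply: cvg_mxP => i j.
  by rewrite (ord1 i); exact: zc.
move=> t _.
have dz : derivable (z : R^o -> 'rV[R]_N) t 1.
  by apply/derivable_mxP => i j; rewrite (ord1 i); have [] := zd j t.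
apply: DeriveDef => //; rewrite (derive_mx dz); apply/matrixP => i j.
by rewrite mxE (ord1 i); have [] := zd j t.
Qed.

Lemma transfer_solution y0 :
  exists z, z 0 = y0 /\ forall T, 0 < T -> pds_solves transfer T z.
Proof.
pose a i := y0 0 i + transfer_dir i * y0 0 k; pose b i := - (transfer_dir i * y0 0 k).
exists (fun t => \row_i (a i + b i * expR (-1 * t))).
split; first by apply/rowP => i; rewrite mxE mulr0 expR0 mulr1 /a /b addrK.
move=> T _; apply: solves_coordP => i t.
  rewrite (_ : (fun u => _) = fun u => a i + b i * expR (-1 * u)).
    by rewrite mxE; exact: cvg_scaled_exp.
  by apply/funext => u; rewrite mxE.
rewrite (_ : (fun u => _) = fun u => a i + b i * expR (-1 * u)).
  apply: (is_derive_eq (is_derive_scaled_exp (a i) (b i) (-1) t)).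
  by rewrite transfer_rhs mxE /a /b transfer_dirk; ring.
by apply/funext => u; rewrite mxE.
Qed.

Lemma transfer_positive y0 T z :
  orthant R 1 N y0 -> z 0 = y0 -> pds_solves transfer T z ->
  forall t, 0 <= t <= T -> orthant R 1 N (z t).
Proof.
move=> oy0 z0 zs.
(* The product of z_k and e^t has derivative zero. *)
have zk t : 0 <= t <= T -> z t 0 k = y0 0 k * expR (-1 * t).
  move=> /andP[t0 tT]; have [zc zd] := solves_coord k (solves_sub tT zs).
  have := @increment_bound R (fun t => z t 0 k * (0 + 1 * expR (1 * t)))
    (fun=> 0) t 0 t0.
  rewrite mul0r !add0r !mul1r expR0 mulr1 => inc.
  have : `|z t 0 k * expR t - z 0 0 k| <= 0.
    apply: inc.
    - apply/subspace_continuousP => s sI; apply: cvgM.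
        by move/subspace_continuousP : zc; exact.
      by apply: cvg_within_filter; exact: cvg_scaled_exp.
    - move=> s st; have h := is_deriveM (zd s st) (is_derive_scaled_exp 0 1 1 s).
      apply: (is_derive_eq h); rewrite transfer_rhs transfer_dirk.
      by rewrite /GRing.scale /=; ring.
    - by move=> s _; rewrite normr0.
  rewrite normr_le0 subr_eq0 z0 => /eqP <-.
  by rewrite mulN1r -mulrA expRxMexpNx_1 mulr1.
move=> t tI a i; rewrite (ord1 a); have [->|ik] := eqVneq i k.
  by rewrite zk // mulr_gt0 // expR_gt0.
have /andP[t0 tT] := tI; have [zc zd] := solves_coord i (solves_sub tT zs).
apply: lt_le_trans (oy0 0 i) _; rewrite -z0.
move: t0; rewrite le_eqVlt => /predU1P[<- //|t0].
have zd' s : s \in `]0, t[ ->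
    is_derive s 1 (fun t => z t 0 i) (pds_rhs transfer (z s) 0 i).
  by rewrite in_itv; exact: zd.
have [c ct E] := MVT t0 zd' zc.
rewrite -subr_ge0 E; apply: mulr_ge0; last by rewrite subr0 ltW.
rewrite transfer_rhs mulr_ge0 ?transfer_dir_ge0 //.
move: ct; rewrite in_itv /= => /andP[c0 ct].
rewrite zk; first by rewrite mulr_ge0 ?expR_ge0 // ltW.
by rewrite (ltW c0) (le_trans (ltW ct) tT).
Qed.

Lemma transfer_pc m : pc_pds m transfer.
Proof.
split.
- by move=> y oy i j; rewrite /= !mxE; split; case: ifP => // _; exact: ltW.
- by move=> y oy i j; rewrite /= !mxE andbC.
- move=> y0 oy0; split; first exact: transfer_solution.
  by move=> T z _ z0 zs t tI; exact: (transfer_positive oy0 z0 zs tI).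
- move=> i j; split.
    rewrite (_ : (fun y => _) = fun y : 'rV[R]_N =>
      (if (i == l) && (j == k) then y 0 k else 0) : R^o).
      by case: (_ && _); [exact: Ck_coord|exact: Ck_cst].
    by apply/funext => y; rewrite /= mxE.
  rewrite (_ : (fun y => _) = fun y : 'rV[R]_N =>
    (if (i == k) && (j == l) then y 0 k else 0) : R^o).
    by case: (_ && _); [exact: Ck_coord|exact: Ck_cst].
  by apply/funext => y; rewrite /= mxE.
Qed.

Lemma transfer_patankar s dt (w : 'I_s -> R) (Y : 'M[R]_(s, N)) (den yn : 'rV[R]_N) :
  0 < dt -> (forall j, 0 <= w j) -> orthant R s N Y -> orthant R 1 N den ->
  orthant R 1 N yn ->
  exists2 y, orthant R 1 N y & patankar transfer dt w Y den yn y.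
Proof.
move=> dt0 w0 oY oden oyn.
pose S := \sum_j w j * Y j k.
have S0 : 0 <= S by apply: sumr_ge0 => j _; rewrite mulr_ge0 // ltW.
have D0 : 0 < den 0 k + dt * S by rewrite ltr_wpDr ?mulr_ge0 // ltW.
(* The equation for component k decouples; q is its Patankar ratio. *)
pose q := yn 0 k / (den 0 k + dt * S).
have q0 : 0 < q by rewrite divr_gt0.
pose y : 'rV[R]_N := \row_i (yn 0 i + transfer_dir i * (dt * S * q)).
have yk : y 0 k = q * den 0 k.
  rewrite mxE transfer_dirk /q; field; exact: lt0r_neq0.
exists y.
  move=> a i; rewrite (ord1 a); have [->|ik] := eqVneq i k.
    by rewrite yk mulr_gt0.
  rewrite mxE; apply: ltr_wpDr; last exact: oyn.
  apply: mulr_ge0; first exact: transfer_dir_ge0.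
  by apply: mulr_ge0; [apply: mulr_ge0 => //|]; exact: ltW.
apply/patankarP => i; rewrite {1}/y mxE; congr (_ + _).
under eq_bigr => j _.
  rewrite transfer_flux yk mulfK ?(lt0r_neq0 (oden 0 k)) // mxE.
  rewrite (_ : w j * _ = (w j * Y j k) * (transfer_dir i * q)); last by ring.
  over.
by rewrite -mulr_suml -/S; ring.
Qed.

End Transfer.

(** * The denominator sigma at dt = 0 *)

Section SigmaAtZero.
Context (R : realType) (s p : nat) (M : mprk R s) (hM : is_mprk p.+1 M).
Context (N : nat) (k l : 'I_N) (kl : k != l).

(** The stages are filled in one after the other: the rows of later stages may
    hold any positive values, since an earlier stage does not see them. *)
Lemma transfer_step_exists dt (yn : 'rV[R]_N) : 0 < dt -> orthant R 1 N yn ->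
  exists Y y1, mprk_step M (transfer R k l) dt yn Y y1.
Proof.
move=> dt0 oyn; have pcT := transfer_pc R kl p.+1.
have [A0 b0 _] := mprk_nonneg hM.
have stages m : exists2 Y, orthant R s N Y & forall i : 'I_s, (i < m)%N ->
    patankar (transfer R k l) dt (bt_A M i) Y
      (mprk_pi M (transfer R k l) i (dt, yn, Y)) yn (row i Y).
  elim: m => [|m [Y oY hY]].
    by exists (\matrix_(_ < s) yn) => //; exact: orthant_const.
  have [ms|sm] := ltnP m s; last first.
    by exists Y => // i im; apply: hY; exact: leq_trans (ltn_ord i) sm.
  pose i0 := Ordinal ms.
  have oden : orthant R 1 N (mprk_pi M (transfer R k l) i0 (dt, yn, Y)).
    by apply: (mprk_pi_gt0 hM) => //; split => //=; exact: ltW.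
  have [y oy hy] := transfer_patankar kl dt0 (A0 i0) oY oden oyn.
  pose Z : 'M[R]_(s, N) := \matrix_(i, j) if i == i0 then y 0 j else Y i j.
  have Zr (j : 'I_s) : j != i0 -> row j Z = row j Y.
    by move=> /negbTE ji; apply/rowP => c; rewrite !mxE ji.
  have Zlt (j i : 'I_s) : (j < i)%N -> (i < m.+1)%N -> row j Z = row j Y.
    move=> ji im; apply: Zr; apply/eqP => ji0; move: ji.
    by rewrite ji0 ltnNge /= -ltnS im.
  exists Z => [i j|i im].
    by rewrite mxE; case: ifP => _; [exact: oy|exact: oY].
  rewrite (mprk_pi_earlier hM dt yn pcT (Y' := Y)); last first.
    by move=> j ji; exact: Zlt ji im.
  have -> : row i Z = if i == i0 then y else row i Y.
    by case: eqVneq => [->|/Zr //]; apply/rowP => c; rewrite !mxE eqxx.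
  apply: (@patankar_congr _ _ _ _ _ _ Y).
    move=> j; have [ji|ij] := ltnP j i; first by right; rewrite (Zlt j i).
    by left; rewrite (mprk_explicit hM).
  case: eqVneq => [->//|ii0]; apply: hY.
  by rewrite ltn_neqAle -ltnS im andbT.
have [Y oY hY] := stages s.
have oden : orthant R 1 N (mprk_sigma M (transfer R k l) (dt, yn, Y)).
  by apply: (mprk_sigma_gt0 hM) => //; split => //=; exact: ltW.
have [y1 _ hy1] := transfer_patankar kl dt0 b0 oY oden oyn.
by exists Y, y1; split => // i; exact: hY.
Qed.

End SigmaAtZero.

Lemma exists_small_interval (R : realType) (P : R -> Prop) :
  (\forall t \near (0 : R)^'+, P t) ->
  exists2 h, 0 < h & forall t, 0 < t <= h -> P t.
Proof.
move=> h.
have /nbhs_closed_ball[r r0 hr] : \forall t \near (0 : R^o), 0 < t -> P t.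
  exact: h.
exists r => // t /andP[t0 tr]; apply: hr => //.
by rewrite subr0 gtr0_norm.
Qed.

Section SigmaId.
Context (R : realType) (s q : nat) (M : mprk R s) (hM : is_mprk q.+3 M).
Hypotheses (sumb : \sum_j bt_b M j = 1) (hMPRK : mprk_order q.+2 M).

(** At dt = 0 sigma depends on y^n alone, so that its value can be read off
    from the linear transfer of mass out of component k, for which consistency forces the Patankar ratio
    y^n_k / sigma_k to be one. *)
Lemma sigma_at_zero N (F : pds R N) (k l : 'I_N) (x0 : 'rV[R]_N) : k != l ->
  pc_pds q.+3 F -> orthant R 1 N x0 ->
  mprk_sigma M F (0, x0, \matrix_(_ < s) x0) 0 k = x0 0 k.
Proof.
move=> kl hF ox0; set T := transfer R k l.
have pcT : pc_pds q.+3 T := transfer_pc R kl q.+3.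
rewrite (mprk_sigma0 hM hF pcT ox0).
have [_ _ posT CkT] := pcT.
have [[z [z0 zs]] _] := posT _ ox0.
have ex dt : exists Yy : 'M[R]_(s, N) * 'rV[R]_N,
    0 < dt -> mprk_step M T dt x0 Yy.1 Yy.2.
  have [dt0|_] := ltP 0 dt; last by exists (0, 0).
  by have [Y [y1 h]] := transfer_step_exists hM kl dt0 ox0; exists (Y, y1).
have [Yy hYy] := choice ex.
pose Fi := (0 : R)^'+; pose dt (t : R) := t.
have FF : Filter Fi by rewrite /Fi; typeclasses eauto.
have pos : \forall t \near Fi, 0 < t by exact: nbhs_right_gt.
have dt_to0 : dt @ Fi --> (0 : R) by exact: (cvg_at_right_filter cvg_id).
have yn_x0 : (fun _ : R => x0) @ Fi --> x0 by exact: cvg_cst.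
have dt_ge0 : \forall t \near Fi, 0 <= dt t by apply: filterS pos => t; exact: ltW.
have st1 : \forall t \near Fi, forall i, patankar T (dt t) (bt_A M i) (Yy t).1
    (mprk_pi M T i (dt t, x0, (Yy t).1)) x0 (row i (Yy t).1).
  by apply: filterS pos => t t0; have [] := hYy t t0.
have st2 : \forall t \near Fi, patankar T (dt t) (bt_b M) (Yy t).1
    (mprk_sigma M T (dt t, x0, (Yy t).1)) x0 (Yy t).2.
  by apply: filterS pos => t t0; have [] := hYy t t0.
pose s0 : 'rV[R]_N := sigma0 M T x0.
have os0 : orthant R 1 N s0.
  apply: (mprk_sigma_gt0 hM pcT); split => //=; exact: orthant_const.
pose proof (stage_increment hM pcT ox0 dt_to0 dt_ge0 yn_x0 st1) as inc.
pose proof (stage_row_cvg hM pcT ox0 dt_to0 dt_ge0 yn_x0 st1) as rowc.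
pose proof (sigma_increment hM pcT ox0 dt_to0 dt_ge0 yn_x0 st1) as sinc.
have s0c : (fun _ : R => s0) @ Fi --> s0 by exact: cvg_cst.
pose proof (patankar_expansion ox0 CkT dt_to0 (w := fun=> bt_b M)
  (fun j => isO_cst (bt_b M j)) rowc inc yn_x0 os0 s0c sinc st2 k) as expy.
have [r [C [r0 C0 hc]]] := rhs_control_exists CkT ox0.
have [K K0 hK] := solution_taylor r0 C0 hc.
have Ctz : Odt Fi dt 2 (fun t => z t 0 k - x0 0 k - t * pds_rhs T x0 0 k).
  exists K; near=> t.
  have t0 : 0 < t by near: t.
  have tC : C * t < r / 2.
    rewrite mulrC -ltr_pdivlMr //; near: t; apply: nbhs_right_lt.
    by rewrite !divr_gt0.
  have z0x : `|z 0 - x0| <= r / 2 by rewrite z0 subrr normr0 ltW // divr_gt0.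
  have [+ _] := hK t z (ltW t0) tC z0x (zs t t0) k.
  by rewrite z0 normrX (gtr0_norm (t0 : 0 < dt t)).
have [d [h [C4 [d0 h0 hC4]]]] := hMPRK pcT ox0.
have Cy1 : Odt Fi dt q.+3 (fun t => (Yy t).2 0 k - z t 0 k).
  exists C4; near=> t.
  have t0 : 0 < t by near: t.
  have th : 0 < t <= h by rewrite t0 /=; near: t; exact: nbhs_right_ltW.
  have := hC4 t x0 (Yy t).1 (Yy t).2 z ox0; rewrite subrr normr0.
  move=> /(_ d0 th z0 (zs t t0) (hYy t t0)) bnd.
  have := coord_le_norm ((Yy t).2 - z t) 0 k; rewrite !mxE => /le_trans; apply.
  apply: le_trans bnd _.
  by rewrite normrX (gtr0_norm (t0 : 0 < dt t)).
have E : Odt Fi dt 2 (fun t => t *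
    (pds_rhs T x0 0 k - flux T x0 (fun nu => x0 0 nu / s0 0 nu) k)).
  pose proof (OdtB (OdtB expy (Odt_weak dt_to0 (m := 2) (n := q.+3) isT Cy1)) Ctz) as e.
  by apply: Odt_eq e => t; rewrite /dt /= sumb; ring.
have [C5 hC5] := E.
have /exists_small_interval[h5 h50 hh5] := hC5.
have : pds_rhs T x0 0 k - flux T x0 (fun nu => x0 0 nu / s0 0 nu) k = 0.
  apply: (@le_pow_eq0 R _ C5 h5 0 h50) => t th; have [t0 _] := andP th.
  move: (hh5 t th); rewrite normrM normrX (gtr0_norm t0) /dt expr1 expr2 mulrCA.
  by rewrite ler_pM2l.
have s0k := os0 0 k; have x0k := ox0 0 k.
rewrite transfer_flux transfer_rhs (transfer_dirk R kl) -/(sigma0 M T x0) -/s0 => e.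
have e2 : x0 0 k * (x0 0 k / s0 0 k - 1) = 0 by rewrite -e; ring.
move/eqP: e2; rewrite mulf_eq0 (gt_eqF x0k) /= subr_eq0 => /eqP e3.
by rewrite -[LHS]mul1r -e3 divfK // gt_eqF.
Unshelve. all: by end_near.
Qed.
End SigmaId.

(** * Dense output over one step *)

Section DenseExpansion.
Context (R : realType) (s k : nat) (M : mprk R s.+1) (hM : is_mprk k.+1 M).
Hypothesis sumb : \sum_j bt_b M j = 1.
Context (N : nat) (F : pds R N) (hF : pc_pds k.+1 F).
Context (x0 : 'rV[R]_N) (ox0 : orthant R 1 N x0).

Definition dense_weight (th : R) (j : 'I_s.+1) : R :=
  if j == ord0 then th - (1 - bt_b M ord0) * th ^+ 2 else th ^+ 2 * bt_b M j.

(** The weights combine an explicit Euler step and the full update, with factors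
    theta - theta^2 and theta^2. *)
Lemma dense_weight_sum th (g : 'I_s.+1 -> R) :
  \sum_j dense_weight th j * g j =
  (th - th ^+ 2) * g ord0 + th ^+ 2 * \sum_j bt_b M j * g j.
Proof.
rewrite (bigD1 ord0) //= [in RHS](bigD1 ord0) //= mulrDr mulr_sumr addrA.
congr (_ + _); first by rewrite /dense_weight eqxx; ring.
by apply: eq_bigr => j /negbTE j0; rewrite /dense_weight j0 mulrA.
Qed.

Lemma dense_weight_total th : \sum_j dense_weight th j = th.
Proof.
under eq_bigr do rewrite -[dense_weight _ _]mulr1.
rewrite (dense_weight_sum th (fun=> 1)).
under eq_bigr do rewrite mulr1.
by rewrite sumb; ring.
Qed.

Context (I : Type) (Fi : set_system I) {FF : Filter Fi}.
Variables (dt th : I -> R) (yn y1 yth : I -> 'rV[R]_N) (Y : I -> 'M[R]_(s.+1, N)).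
Hypothesis dt_to0 : dt @ Fi --> (0 : R).
Hypothesis dt_ge0 : \forall i \near Fi, 0 <= dt i.
Hypothesis yn_x0 : yn @ Fi --> x0.
Hypothesis th01 : \forall i \near Fi, 0 <= th i <= 1.

Let den i := mprk_sigma M F (dt i, yn i, Y i).
Let denth i := (1 - th i) *: yn i + th i *: den i.

Hypothesis step : \forall i \near Fi, mprk_step M F (dt i) (yn i) (Y i) (y1 i).
Hypothesis dense : \forall i \near Fi,
  patankar F (dt i) (dense_weight (th i)) (Y i) (denth i) (yn i) (yth i).

Let stages : \forall i \near Fi, forall l,
  patankar F (dt i) (bt_A M l) (Y i) (mprk_pi M F l (dt i, yn i, Y i)) (yn i)
    (row l (Y i)).
Proof. by apply: filterS step => i []. Qed.

Let update : \forall i \near Fi,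
  patankar F (dt i) (bt_b M) (Y i) (den i) (yn i) (y1 i).
Proof. by apply: filterS step => i []. Qed.

Lemma first_stage : \forall i \near Fi, row ord0 (Y i) = yn i.
Proof.
apply: filterS stages => i /(_ ord0) h; apply/rowP => c.
rewrite (h c) big1 ?mulr0 ?addr0 // => j _.
by rewrite (mprk_explicit hM) ?mul0r.
Qed.

Let theta_bounded m (u : I -> R) : Odt Fi dt m u -> Odt Fi dt m (fun i => th i * u i).
Proof.
apply: isO_le; apply: filterS th01 => i /andP[t0 t1].
by rewrite normrM ler_piMl // ger0_norm.
Qed.

Hypothesis sigma_id : forall x, orthant R 1 N x -> sigma0 M F x = x.

(** Up to O(dt^3) the left-hand side is dt theta times the
    production-destruction operator at y^n applied to
    (v(theta) - 1) - theta (v(1) - 1), where v(theta) and v(1) are the Patankar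
    ratios of the dense output and of the update.  This difference is O(dt^2)
    because theta enters the numerators and the denominators affinely to first
    order. *)
Lemma dense_expansion_sigma l : Odt Fi dt 3 (fun i =>
  yth i 0 l - yn i 0 l - (th i - th i ^+ 2) * (dt i * pds_rhs F (yn i) 0 l)
  - th i ^+ 2 * (y1 i 0 l - yn i 0 l)).
Proof.
have [_ _ _ Fk] := hF.
pose proof (stage_increment hM hF ox0 dt_to0 dt_ge0 yn_x0 stages) as inc.
pose proof (stage_row_cvg hM hF ox0 dt_to0 dt_ge0 yn_x0 stages) as rowc.
have near_oyn : \forall i \near Fi, orthant R 1 N (yn i).
  exact: yn_x0 (orthant_nbhs ox0).
have dinc nu : Odt Fi dt 1 (fun i => den i 0 nu - yn i 0 nu).
  pose proof (sigma_increment hM hF ox0 dt_to0 dt_ge0 yn_x0 stages nu) as h.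
  by apply: Odt_near h; apply: filterS near_oyn => i /sigma_id ->.
have dthinc nu : Odt Fi dt 1 (fun i => denth i 0 nu - yn i 0 nu).
  by apply: Odt_eq (theta_bounded (dinc nu)) => i; rewrite /denth !mxE; ring.
have O0_isO (u : I -> R) : Odt Fi dt 0 u -> isO Fi (fun=> 1) u.
  by move=> [C hC]; exists C; apply: filterS hC => i; rewrite expr0.
have wth j : isO Fi (fun=> 1) (fun i => dense_weight (th i) j).
  apply: O0_isO.
  have t1 : Odt Fi dt 0 th.
    by apply: Odt_eq (theta_bounded (Odt_cst dt 1)) => i; rewrite mulr1.
  have t2 : Odt Fi dt 0 (fun i => th i ^+ 2).
    by apply: Odt_eq (theta_bounded t1) => i; rewrite expr2.
  rewrite /dense_weight; case: eqP => _.
    exact: (OdtB t1 (OdtM (Odt_cst dt _) t2)).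
  exact: (OdtM t2 (Odt_cst dt _)).
have ratio1 i c : orthant R 1 N (yn i) ->
    flux F (yn i) (fun nu => yn i 0 nu / yn i 0 nu) c = pds_rhs F (yn i) 0 c.
  by move=> oy; rewrite -flux1; apply: eq_flux => nu; rewrite divff // gt_eqF.
have exp1 nu : Odt Fi dt 2 (fun i => y1 i 0 nu - yn i 0 nu
    - dt i * pds_rhs F (yn i) 0 nu).
  pose proof (patankar_expansion ox0 Fk dt_to0 (w := fun=> bt_b M)
    (fun j => isO_cst (bt_b M j)) rowc inc yn_x0 ox0 yn_x0 dinc update nu) as h.
  apply: Odt_near h; apply: filterS near_oyn => i oyi.
  by rewrite ratio1 // sumb mul1r.
have expth nu : Odt Fi dt 2 (fun i => yth i 0 nu - yn i 0 nu
    - th i * (dt i * pds_rhs F (yn i) 0 nu)).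
  pose proof (patankar_expansion ox0 Fk dt_to0 wth rowc inc yn_x0 ox0 yn_x0
    dthinc dense nu) as h.
  apply: Odt_near h; apply: filterS near_oyn => i oyi.
  by rewrite ratio1 // dense_weight_total mulrCA.
have dencvg (d : I -> 'rV[R]_N) :
    (forall nu, Odt Fi dt 1 (fun i => d i 0 nu - yn i 0 nu)) ->
    (forall nu, Odt Fi dt 0 (fun i => (d i 0 nu)^-1)) /\
    \forall i \near Fi, forall nu, d i 0 nu != 0.
  move=> dinc'; have dx0 : d @ Fi --> x0.
    apply: cvg_mxP => a c; rewrite (ord1 a).
    by apply: (Odt_dist_cvg dt_to0 (dinc' c)); exact: cvg_coord.
  have [h1 h2] := orthant_cvg_inv ox0 dx0.
  by split=> // nu; exact: Odt0.
have [denb den_neq0] := dencvg _ dinc.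
have [denthb denth_neq0] := dencvg _ dthinc.
have y1inc nu : Odt Fi dt 1 (fun i => y1 i 0 nu - yn i 0 nu).
  exact: (patankar_increment ox0 Fk dt_to0 (w := fun=> bt_b M)
    (fun j => isO_cst (bt_b M j)) rowc (fun mu => O0_isO _ (denb mu)) yn_x0 update).
have ythinc nu : Odt Fi dt 1 (fun i => yth i 0 nu - yn i 0 nu).
  exact: (patankar_increment ox0 Fk dt_to0 wth rowc
    (fun mu => O0_isO _ (denthb mu)) yn_x0 dense).
pose v1 i nu := y1 i 0 nu / den i 0 nu.
pose vth i nu := yth i 0 nu / denth i 0 nu.
have v1_1 nu : Odt Fi dt 1 (fun i => v1 i nu - 1).
  pose proof (OdtM (OdtB (y1inc nu) (dinc nu)) (denb nu)) as h.
  move: h; rewrite addn0; apply: Odt_near; apply: filterS den_neq0 => i /(_ nu) h.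
  by rewrite /v1; field.
have vth_1 nu : Odt Fi dt 1 (fun i => vth i nu - 1).
  pose proof (OdtM (OdtB (ythinc nu) (dthinc nu)) (denthb nu)) as h.
  move: h; rewrite addn0; apply: Odt_near; apply: filterS denth_neq0 => i /(_ nu) h.
  by rewrite /vth; field.
have key nu : Odt Fi dt 2 (fun i => (vth i nu - 1) - th i * (v1 i nu - 1)).
  pose proof (OdtD
    (OdtM (OdtB (expth nu) (theta_bounded (exp1 nu))) (denthb nu))
    (theta_bounded (OdtM (OdtB (y1inc nu) (dinc nu))
      (OdtM (OdtB (dinc nu) (dthinc nu)) (OdtM (denthb nu) (denb nu)))))) as h.
  move: h; apply: Odt_near; apply: filterS2 den_neq0 denth_neq0.
  move=> i /(_ nu) h1 /(_ nu) h2; rewrite /vth /v1.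
  have E : denth i 0 nu = yn i 0 nu + th i * (den i 0 nu - yn i 0 nu).
    by rewrite /denth !mxE; ring.
  move: h2; rewrite E; move: (den i 0 nu) h1 (yn i 0 nu) => d h1 c h2.
  by field; rewrite h1 h2.
have dv nu : Odt Fi dt 1 (fun i => vth i nu - v1 i nu).
  by apply: Odt_eq (OdtB (vth_1 nu) (v1_1 nu)) => i; ring.
have main1 : Odt Fi dt 2 (fun i => th i * flux F (yn i)
    (fun nu => (vth i nu - 1) - th i * (v1 i nu - 1)) l).
  by apply: theta_bounded; exact: (flux_isO ox0 Fk l yn_x0 key).
have main2 : Odt Fi dt 2 (fun i => th i * (th i * \sum_j bt_b M j *
    (flux F (row j (Y i)) (fun nu => vth i nu - v1 i nu) l -
     flux F (yn i) (fun nu => vth i nu - v1 i nu) l))).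
  apply: theta_bounded; apply: theta_bounded; apply: Odt_sum => j _.
  rewrite -[2%N]/(0 + 2)%N; apply: OdtM; first exact: Odt_cst.
  have Yr nu : Odt Fi dt 1 (fun i => row j (Y i) 0 nu - yn i 0 nu).
    by apply: Odt_eq (inc j nu) => i; rewrite mxE.
  exact: (flux_Odt_diff ox0 Fk l (rowc j) yn_x0 Yr dv).
pose proof (OdtM (Odt_dt dt) (OdtD main1 main2)) as h.
apply: Odt_near h; apply: filterS3 first_stage update dense => i h0 hu hd.
rewrite (hd l) (hu l) !(addrC (yn i 0 l)) !addrK.
rewrite (dense_weight_sum _ (fun j => flux F (row j (Y i)) (vth i) l)) h0.
rewrite fluxB fluxZ !fluxB -flux1.
under eq_bigr => j _.
  rewrite (_ : bt_b M j * _ = bt_b M j * flux F (row j (Y i)) (vth i) l -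
    bt_b M j * flux F (row j (Y i)) (v1 i) l -
    bt_b M j * (flux F (yn i) (vth i) l - flux F (yn i) (v1 i) l)); last first.
    by rewrite !fluxB; ring.
  over.
rewrite !sumrB -mulr_suml sumb mul1r.
rewrite -/(v1 i).
ring.
Qed.

(** With a single component, consistency says nothing about sigma, but
    conservation makes the system trivial. *)
Lemma dense_expansion_single l : (forall a b : 'I_N, a = b) -> Odt Fi dt 3 (fun i =>
  yth i 0 l - yn i 0 l - (th i - th i ^+ 2) * (dt i * pds_rhs F (yn i) 0 l)
  - th i ^+ 2 * (y1 i 0 l - yn i 0 l)).
Proof.
move=> single; have [_ consF _ _] := hF.
have flux0 y v : orthant R 1 N y -> flux F y v l = 0.
  move=> oy; apply: big1 => nu _.
  by rewrite (single nu l) (consF _ oy) subrr.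
pose proof (stage_row_cvg hM hF ox0 dt_to0 dt_ge0 yn_x0 stages) as rowc.
have orow : \forall i \near Fi, forall j, orthant R 1 N (row j (Y i)).
  by apply: filter_forall => j; exact: rowc j _ (orthant_nbhs ox0).
have near_oyn : \forall i \near Fi, orthant R 1 N (yn i).
  exact: yn_x0 (orthant_nbhs ox0).
have h : Odt Fi dt 3 (fun=> 0) by exact: isO0.
apply: Odt_near h; near=> i.
have oyn : orthant R 1 N (yn i) by near: i.
have or j : orthant R 1 N (row j (Y i)) by move: j; near: i.
have hu : patankar F (dt i) (bt_b M) (Y i) (den i) (yn i) (y1 i) by near: i.
have hd : patankar F (dt i) (dense_weight (th i)) (Y i) (denth i) (yn i) (yth i).
  by near: i.
rewrite (hu l) (hd l) -flux1 flux0 //.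
rewrite [X in yn i 0 l + dt i * X](_ : _ = 0); last first.
  by apply: big1 => j _; rewrite [X in _ * X]flux0 ?mulr0.
rewrite [X in th i ^+ 2 * (yn i 0 l + dt i * X - _)](_ : _ = 0); last first.
  by apply: big1 => j _; rewrite [X in _ * X]flux0 ?mulr0.
ring.
Unshelve. all: by end_near.
Qed.

End DenseExpansion.

(** * Uniform one-step estimates *)

Section LocalEstimates.
Context (R : realType) (s : nat) (M : mprk R s.+1) (hM : is_mprk 4 M).
Hypotheses (sumb : \sum_j bt_b M j = 1) (hMPRK : mprk_order 3 M).
Context (N : nat) (F : pds R N) (hF : pc_pds 4 F).

(** The index type of the family of all steps near a point. *)
Record dense_step := DenseStep {
  ds_dt : R; ds_th : R; ds_yn : 'rV[R]_N; ds_y1 : 'rV[R]_N; ds_yth : 'rV[R]_N;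
  ds_Y : 'M[R]_(s.+1, N) }.

Definition dense_den (d : dense_step) : 'rV[R]_N :=
  (1 - ds_th d) *: ds_yn d +
  ds_th d *: mprk_sigma M F (ds_dt d, ds_yn d, ds_Y d).

Definition valid_step (d : dense_step) : Prop :=
  [/\ 0 < ds_dt d, 0 <= ds_th d <= 1,
      mprk_step M F (ds_dt d) (ds_yn d) (ds_Y d) (ds_y1 d) &
      patankar F (ds_dt d) (dense_weight M (ds_th d)) (ds_Y d) (dense_den d)
        (ds_yn d) (ds_yth d)].

Definition small_step (x0 : 'rV[R]_N) (e : R) : set dense_step :=
  [set d | [/\ valid_step d, ds_dt d <= e & `|ds_yn d - x0| <= e]].

Definition small_steps (x0 : 'rV[R]_N) : set_system dense_step :=
  filter_from [set e : R | 0 < e] (small_step x0).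

Lemma small_steps_filter x0 : Filter (small_steps x0).
Proof.
apply: filter_from_filter; first by exists 1 => /=.
move=> a b a0 b0; exists (Num.min a b); first by rewrite /= lt_min a0 b0.
move=> d [vd]; rewrite !le_min => /andP[da db] /andP[ya yb].
by split; split.
Qed.

(** Zero when yth is the value at th of the quadratic with value y0 and slope
    dt f(y0) at 0 and with value y1 at 1. *)
Definition hermite_defect (dt th : R) (y0 yth y1 : 'rV[R]_N) (l : 'I_N) : R :=
  yth 0 l - y0 0 l - (th - th ^+ 2) * (dt * pds_rhs F y0 0 l)
  - th ^+ 2 * (y1 0 l - y0 0 l).

Lemma dense_local x0 : orthant R 1 N x0 -> exists C e : R, 0 < e /\
  forall d, small_step x0 e d -> forall l,
    `|hermite_defect (ds_dt d) (ds_th d) (ds_yn d) (ds_yth d) (ds_y1 d) l|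
      <= C * ds_dt d ^+ 3.
Proof.
move=> ox0; have FF := small_steps_filter x0.
have dt_to0 : ds_dt @ small_steps x0 --> (0 : R).
  apply/cvgr0Pnorm_le => e e0; exists e => // d [[dt0 _ _ _] de _].
  by rewrite gtr0_norm.
have dt_ge0 : \forall d \near small_steps x0, 0 <= ds_dt d.
  by exists 1 => //= d [[dt0 _ _ _] _ _]; exact: ltW.
have yn_x0 : ds_yn @ small_steps x0 --> x0.
  by apply/cvgrPdist_le => e e0; exists e => // d [_ _]; rewrite distrC.
have th01 : \forall d \near small_steps x0, 0 <= ds_th d <= 1.
  by exists 1 => //= d [[]].
have step : \forall d \near small_steps x0,
    mprk_step M F (ds_dt d) (ds_yn d) (ds_Y d) (ds_y1 d).
  by exists 1 => //= d [[]].
have dense : \forall d \near small_steps x0,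
    patankar F (ds_dt d) (dense_weight M (ds_th d)) (ds_Y d) (dense_den d)
        (ds_yn d) (ds_yth d).
  by exists 1 => //= d [[]].
have O3 l : Odt (small_steps x0) ds_dt 3 (fun d =>
    hermite_defect (ds_dt d) (ds_th d) (ds_yn d) (ds_yth d) (ds_y1 d) l).
  have [[l' ll']|single] := pselect (exists l' : 'I_N, l' != l).
    apply: (dense_expansion_sigma hM sumb hF ox0 dt_to0 dt_ge0 yn_x0 th01 step dense).
    move=> x ox; apply/rowP => j.
    have [l2 jl2] : exists l2, j != l2.
      have [->|jl] := eqVneq j l; last by exists l.
      by exists l'; rewrite eq_sym.
    exact: (@sigma_at_zero R s.+1 1 M hM sumb hMPRK N F j l2 x jl2 hF ox).
  apply: (dense_expansion_single hM hF ox0 dt_to0 dt_ge0 yn_x0 step dense).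
  have all_l a : a = l.
    by apply/eqP/negP => al; apply: single; exists a; apply/negP.
  by move=> a b; rewrite (all_l a) (all_l b).
have O3n : isO (small_steps x0) (fun d => ds_dt d ^+ 3)
    (fun d => \sum_l `|hermite_defect (ds_dt d) (ds_th d) (ds_yn d) (ds_yth d)
      (ds_y1 d) l|).
  apply: isO_sum => l _; apply: isO_le (O3 l); apply: nearW => d.
  by rewrite normr_id.
have [C [e e0 he]] := O3n; exists C, e; split=> // d hd l.
have [[dt0 _ _ _] _ _] := hd.
have := he d hd => /=; rewrite normrX (gtr0_norm dt0); apply: le_trans.
rewrite [leRHS]ger0_norm; last by apply: sumr_ge0.
by rewrite (bigD1 l) //= lerDl sumr_ge0.
Qed.

(** All that the convergence proof needs to know about one step of length dt
    from yn, compared with the exact solution through x. *)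
Record step_estimates (K : R) (x yn : 'rV[R]_N) (dt : R) : Prop := StepEstimates {
  se_pos : orthant R 1 N yn;
  se_consistent : forall z Y y1, z 0 = yn -> pds_solves F dt z ->
    mprk_step M F dt yn Y y1 -> `|y1 - z dt| <= K * dt ^+ 4;
  se_dense : forall th Y y1 yth, 0 <= th <= 1 -> mprk_step M F dt yn Y y1 ->
    patankar F dt (dense_weight M th) Y
      ((1 - th) *: yn + th *: mprk_sigma M F (dt, yn, Y)) yn yth ->
    forall l, `|hermite_defect dt th yn yth y1 l| <= K * dt ^+ 3;
  se_hermite : forall z th, z 0 = yn -> pds_solves F dt z -> 0 <= th <= 1 ->
    forall l, `|hermite_defect dt th yn (z (th * dt)) (z dt) l| <= K * dt ^+ 3;
  se_lipschitz : forall l,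
    `|pds_rhs F yn 0 l - pds_rhs F x 0 l| <= K * `|yn - x|;
  se_stable : forall z1 z2, z1 0 = yn -> z2 0 = x ->
    pds_solves F dt z1 -> pds_solves F dt z2 ->
    `|z1 dt - z2 dt| <= (1 + K * dt) * `|yn - x| }.

Lemma step_estimates_le K K' x yn dt : 0 < dt -> K <= K' ->
  step_estimates K x yn dt -> step_estimates K' x yn dt.
Proof.
move=> dt0 KK' [pos cons dens herm lip stab].
have pw n : K * dt ^+ n <= K' * dt ^+ n by rewrite ler_wpM2r // exprn_ge0 // ltW.
split=> //.
- by move=> z Y y1 h1 h2 h3; exact: le_trans (cons z Y y1 h1 h2 h3) (pw _).
- move=> th Y y1 yth h1 h2 h3 l.
  exact: le_trans (dens th Y y1 yth h1 h2 h3 l) (pw _).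
- by move=> z th h1 h2 h3 l; exact: le_trans (herm z th h1 h2 h3 l) (pw _).
- by move=> l; apply: le_trans (lip l) _; rewrite ler_wpM2r.
- move=> z1 z2 h1 h2 h3 h4; apply: le_trans (stab z1 z2 h1 h2 h3 h4) _.
  by rewrite ler_wpM2r // lerD2l ler_wpM2r // ltW.
Qed.

Lemma step_estimates_local x0 : orthant R 1 N x0 ->
  exists K e : R, 0 < e /\ forall x yn dt, `|x - x0| <= e -> `|yn - x0| <= e ->
    0 < dt <= e -> step_estimates K x yn dt.
Proof.
move=> ox0; have [_ _ _ Fk] := hF.
have [K1 [e1 [e10 hdense]]] := dense_local ox0.
have [d [h [K2 [d0 h0 hcons]]]] := hMPRK hF ox0.
have [r [C [r0 C0 hc]]] := rhs_control_exists Fk ox0.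
have [K3 K30 hherm] := solution_hermite r0 C0 hc.
have /exists_small[r1 r10 hr1] := orthant_ball ox0.
pose K := `|K1| + `|K2| + K3 + 2 * C.
have [KK1 KK2 KK3 KK4] : [/\ K1 <= K, K2 <= K, K3 <= K & 2 * C <= K].
  have := ler_norm K1; have := ler_norm K2; have := normr_ge0 K1; have := normr_ge0 K2.
  by rewrite /K; split; lra.
have rC0 : 0 < r / 4 / C by rewrite !divr_gt0.
have C40 : 0 < 1 / (2 * C) by rewrite divr_gt0 // mulr_gt0.
pose e := Num.min (Num.min (Num.min e1 (d / 2)) (Num.min h (r / 2)))
  (Num.min (Num.min (r / 4 / C) (1 / (2 * C))) r1).
have e0 : 0 < e by rewrite !lt_min e10 h0 r10 rC0 C40 !divr_gt0.
have [[ee1 ed] [eh er] [eC eC2 er1]] : [/\ e <= e1 /\ e <= d / 2, e <= h /\ e <= r / 2 &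
    [/\ e <= r / 4 / C, e <= 1 / (2 * C) & e <= r1]].
  by rewrite /e !ge_min !lexx !orbT.
exists K, e; split=> // x yn dt hx hyn /andP[dt0 dte].
have Cdt1 : C * dt < r / 2.
  have : dt * C <= r / 4 by rewrite -ler_pdivlMr // (le_trans dte eC).
  by rewrite mulrC; lra.
have Cdt2 : C * dt <= 1 / 2.
  have := le_trans dte eC2; rewrite ler_pdivlMr ?mulr_gt0 //; lra.
have r2 : r / 2 <= r by lra.
have oyn : orthant R 1 N yn.
  by move=> a i; apply: lt_le_trans r10 (hr1 yn (le_trans hyn er1) a i).
split=> //.
- move=> z Y y1 z0 zs st.
  have near_x0 : `|yn - x0| < d.
    by apply: le_lt_trans hyn (le_lt_trans ed _); lra.
  have dth : 0 < dt <= h by rewrite dt0 (le_trans dte eh).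
  apply: le_trans (hcons dt yn Y y1 z oyn near_x0 dth z0 zs st) _.
  by rewrite ler_wpM2r // exprn_ge0 // ltW.
- move=> th Y y1 yth th01 st pd l.
  have small : small_step x0 e1 (DenseStep dt th yn y1 yth Y).
    by split; [split|exact: le_trans dte ee1|exact: le_trans hyn ee1].
  apply: le_trans (hdense _ small l) _ => /=.
  by rewrite ler_wpM2r // exprn_ge0 // ltW.
- move=> z th z0 zs th01 l.
  have := hherm dt z th (ltW dt0) Cdt1 _ zs th01 l; rewrite z0 => hh.
  apply: le_trans (hh (le_trans hyn er)) _.
  by rewrite ler_wpM2r // exprn_ge0 // ltW.
- move=> l; have := rhs_lipschitz hc l (le_trans (le_trans hyn er) r2)
    (le_trans (le_trans hx er) r2).
  move=> /le_trans; apply; rewrite ler_wpM2r //; lra.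
- move=> z1 z2 z10 z20 s1 s2.
  have := flow_stability C0 hc (ltW dt0) Cdt1 Cdt2 _ _ s1 s2.
  rewrite z10 z20 => hh; apply: le_trans (hh (le_trans hyn er) (le_trans hx er)) _.
  by rewrite ler_wpM2r // lerD2l ler_wpM2r // ltW.
Qed.

(** One parameter e controls the radius, the step size and the constant 1 / e,
    so that compactness can be applied along the filter e -> 0. *)
Lemma step_estimates_compact (A : set 'rV[R]_N) : compact A ->
  A `<=` orthant R 1 N ->
  exists2 e : R, 0 < e & forall x yn dt, A x -> `|yn - x| <= e -> 0 < dt <= e ->
    step_estimates e^-1 x yn dt.
Proof.
move=> /compact_near_coveringP cA oA.
have /exists_small[e e0 he] : \forall e \near (0 : R)^'+, A `<=` [set x |
    forall yn dt, `|yn - x| <= e -> 0 < dt <= e -> step_estimates e^-1 x yn dt].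
  apply: (cA R (0 : R)^'+ (fun e x => forall yn dt, `|yn - x| <= e -> 0 < dt <= e ->
    step_estimates e^-1 x yn dt)) => x0 /oA ox0.
  have [K [e [e0 he]]] := step_estimates_local ox0.
  pose b := Num.min (e / 2) (`|K| + 1)^-1.
  have K0 : 0 < `|K| + 1 by rewrite ltr_wpDl.
  have b0 : 0 < b by rewrite lt_min divr_gt0 // invr_gt0.
  exists ([set x | `|x - x0| <= e / 2], [set a : R | 0 < a /\ a <= b]) => /=.
    split.
      have e20 : 0 < e / 2 by rewrite divr_gt0.
      have /cvgrPdist_le /(_ _ e20) : x @[x --> x0] --> x0 by exact: cvg_id.
      by apply: filterS => x; rewrite distrC.
    by near=> a; split; near: a; [exact: nbhs_right_gt|exact: nbhs_right_ltW].
  move=> [x a] /= [hx [a0]]; rewrite le_min => /andP[ae aK] yn dt hyn /andP[dt0 dta].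
  apply: (step_estimates_le dt0 (K := K)).
    apply: le_trans (ler_norm K) _; apply: (@le_trans _ _ (`|K| + 1)).
      by rewrite lerDl.
    by rewrite -[leLHS]invrK lef_pV2 // posrE // invr_gt0.
  apply: he; [by apply: le_trans hx _; lra| |by rewrite dt0 /=; lra].
  by have := ler_distD x yn x0; lra.
by exists e => // x yn dt /he; exact.
Unshelve. all: by end_near.
Qed.

End LocalEstimates.

(** * Convergence *)

Section Convergence.
Context (R : realType) (s : nat) (M : mprk R s.+1) (hM : is_mprk 4 M).
Hypotheses (sumb : \sum_j bt_b M j = 1) (hMPRK : mprk_order 3 M).
Context (N : nat) (F : pds R N) (hF : pc_pds 4 F).

(** The errors e_n of the scheme satisfy e_(n+1) <= (1 + K dt) e_n + K dt^4 as
    long as y^n is close to the trajectory, which the resulting bound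
    e_n <= ((1 + K dt)^n - 1) dt^3 guarantees for small dt.  The dense output is
    then compared with the solution through their quadratic interpolants. *)
Lemma dense_output_convergent : dense_convergent 3 M F (dense_weight M)
  (fun th yn sigma => (1 - th) *: yn + th *: sigma).
Proof.
move=> y0 oy0 T z T0 z0 zs; have [_ _ posF _] := hF.
have oz t : 0 <= t <= T -> orthant R 1 N (z t).
  by have [_ h] := posF y0 oy0; exact: h T z T0 z0 zs t.
have cA : compact (z @` `[0, T]%classic).
  by apply: continuous_compact; [have [] := zs|exact: segment_compact].
have [e e0 he] : exists2 e : R, 0 < e & forall x yn dt,
    (z @` `[0, T]%classic) x -> `|yn - x| <= e -> 0 < dt <= e ->
    step_estimates M F e^-1 x yn dt.
  apply: step_estimates_compact => // _ [t tT <-]; apply: oz.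
  by move: tT; rewrite /= in_itv.
pose K := e^-1; have K0 : 0 < K by rewrite invr_gt0.
pose G := expR (K * T); have G0 : 0 < G by exact: expR_gt0.
pose h := Num.min (Num.min e 1) (e / G).
have h0 : 0 < h by rewrite !lt_min e0 ltr01 divr_gt0.
have [h_e h_1 h_G] : [/\ h <= e, h <= 1 & h <= e / G].
  by rewrite /h !ge_min !lexx !orbT.
(* The errors at the two ends of the step enter the interpolant with total
   factor 4; the two interpolation defects contribute K each. *)
exists h, (4 * G + 2 * K); split=> //.
move=> dt y Y /andP[dt0 dth] y00 steps n th yth nT th01 pd.
have dte : 0 < dt <= e by rewrite dt0 (le_trans dth h_e).
have dt3 : 0 <= dt ^+ 3 by rewrite exprn_ge0 // ltW.
have Kdt : K * dt <= 1 by rewrite -ler_pdivlMl // mulr1 /K invrK (le_trans dth h_e).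
have Kdt0 : 0 <= K * dt by rewrite mulr_ge0 // ltW.
pose t m : R := m%:R * dt.
have t0 m : 0 <= t m by rewrite mulr_ge0 // ltW.
have tS m : t m.+1 = t m + dt by rewrite /t -natr1 mulrDl mul1r.
have At m : t m <= T -> (z @` `[0, T]%classic) (z (t m)).
  by move=> tT; exists (t m) => //=; rewrite in_itv /= t0.
have pow_G m : t m <= T -> (1 + K * dt) ^+ m <= G.
  move=> tT; apply: (@le_trans _ _ (expR (K * dt) ^+ m)).
    by apply: lerXn2r; rewrite ?nnegrE ?expR_ge0 ?expR_ge1Dx // addr_ge0.
  by rewrite -expRM_natl ler_expR mulrCA ler_pM2l.
have dtG : G * dt ^+ 3 <= e.
  apply: (@le_trans _ _ (G * dt)).
    rewrite ler_pM2l // exprS ler_piMr ?(ltW dt0) // exprn_ile1 ?(ltW dt0) //.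
    exact: le_trans dth h_1.
  by rewrite mulrC -ler_pdivlMr // (le_trans dth).
have close m : `|y m - z (t m)| <= ((1 + K * dt) ^+ m - 1) * dt ^+ 3 -> t m <= T ->
    `|y m - z (t m)| <= G * dt ^+ 3.
  move=> hm tT; apply: le_trans hm _; rewrite ler_wpM2r //.
  by have := pow_G m tT; lra.
have shift m : t m.+1 <= T -> pds_solves F dt (fun u => z (t m + u)).
  by rewrite tS => tT; exact: solves_shift (t0 m) tT zs.
have tle m : t m.+1 <= T -> t m <= T.
  by rewrite tS => tT; apply: le_trans tT; rewrite lerDl ltW.
have global m : t m <= T -> `|y m - z (t m)| <= ((1 + K * dt) ^+ m - 1) * dt ^+ 3.
  elim: m => [|m ih] tT.
    by rewrite /t mul0r y00 z0 subrr normr0 expr0 subrr mul0r.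
  have em := ih (tle m tT).
  have near_e := le_trans (close m em (tle m tT)) dtG.
  have est := he _ _ _ (At m (tle m tT)) near_e dte.
  have [[zeta [zeta0 zetas]] _] := posF _ (se_pos est).
  have c := se_consistent est zeta0 (zetas _ dt0) (steps m tT).
  have st := se_stable est zeta0 _ (zetas _ dt0) (shift m tT).
  rewrite addr0 -tS in st; have {}st := st erefl.
  apply: le_trans (ler_distD (zeta dt) _ _) _; apply: le_trans (lerD c st) _.
  have -> : ((1 + K * dt) ^+ m.+1 - 1) * dt ^+ 3 = K * dt ^+ 4 +
     (1 + K * dt) * (((1 + K * dt) ^+ m - 1) * dt ^+ 3) by rewrite exprS; ring.
  by rewrite lerD2l ler_wpM2l // addr_ge0.
have tnT : t n <= T := tle n nT.
have En := close n (global n tnT) tnT.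
have En1 := close n.+1 (global n.+1 nT) nT.
have est := he _ _ _ (At n tnT) (le_trans En dtG) dte.
have self : `|z (t n) - z (t n)| <= e by rewrite subrr normr0 ltW.
have estz := he _ _ _ (At n tnT) self dte.
apply/mx_norm_leP => [|a l]; first by rewrite mulr_ge0 // addr_ge0 // mulr_ge0 // ltW.
rewrite (ord1 a) !mxE.
have D1 := se_dense est th01 (steps n nT) pd l.
have D2 := se_hermite estz (z := fun u => z (t n + u)) (th := th) _ (shift n nT) th01 l.
rewrite addr0 -tS in D2; have {}D2 := D2 erefl.
have L := se_lipschitz est l.
have LB : `|pds_rhs F (y n) 0 l - pds_rhs F (z (t n)) 0 l| <= K * (G * dt ^+ 3).
  by apply: le_trans L _; rewrite ler_pM2l.
have {}En := le_trans (coord_le_norm (y n - z (t n)) 0 l) En.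
have {}En1 := le_trans (coord_le_norm (y n.+1 - z (t n.+1)) 0 l) En1.
move: En En1 D1 D2 LB; rewrite 4!mxE /hermite_defect -/K -/(t n).
move: (yth 0 l) (z (t n + th * dt) 0 l) (y n 0 l) (z (t n) 0 l) (y n.+1 0 l)
  (z (t n.+1) 0 l) (pds_rhs F (y n) 0 l) (pds_rhs F (z (t n)) 0 l).
move=> u v un vn u1 v1 fu fv En En1 D1 D2 LB.
have /andP[th0 th1] := th01.
have th2_0 : 0 <= th ^+ 2 by rewrite sqr_ge0.
have th2_1 : th ^+ 2 <= 1 by rewrite exprn_ile1.
have th2_th : th ^+ 2 <= th by rewrite expr2 ler_piMl.
have B0 : 0 <= G * dt ^+ 3 by rewrite mulr_ge0 // ltW.
have slope : `|(th - th ^+ 2) * (dt * (fu - fv))| <= G * dt ^+ 3.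
  rewrite normrM ger0_norm ?subr_ge0 // normrM (gtr0_norm dt0).
  have h1 : dt * `|fu - fv| <= dt * (K * (G * dt ^+ 3)) by rewrite ler_pM2l.
  have h2 : dt * (K * (G * dt ^+ 3)) <= G * dt ^+ 3.
    by rewrite mulrA [dt * K]mulrC ler_piMl.
  have h3 : 0 <= dt * `|fu - fv| by rewrite mulr_ge0 // ltW.
  have h4 : th - th ^+ 2 <= 1 by lra.
  by apply: le_trans (le_trans h1 h2); rewrite ler_piMl.
have ends : `|th ^+ 2 * ((u1 - v1) - (un - vn))| <= 2 * (G * dt ^+ 3).
  rewrite normrM ger0_norm //; apply: le_trans (ler_piMl _ th2_1) _ => //.
  by apply: le_trans (ler_normB _ _) _; rewrite mulrDl mul1r lerD.
rewrite (_ : u - v = (u - un - (th - th ^+ 2) * (dt * fu) - th ^+ 2 * (u1 - un))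
  - (v - vn - (th - th ^+ 2) * (dt * fv) - th ^+ 2 * (v1 - vn))
  + (un - vn) + (th - th ^+ 2) * (dt * (fu - fv))
  + th ^+ 2 * ((u1 - v1) - (un - vn))); last by ring.
rewrite (_ : (4 * G + 2 * K) * dt ^+ 3 = (K * dt ^+ 3 + K * dt ^+ 3 + G * dt ^+ 3
  + G * dt ^+ 3) + 2 * (G * dt ^+ 3)); last by ring.
apply: le_trans (ler_normD _ _) _; apply: lerD => //.
apply: le_trans (ler_normD _ _) _; apply: lerD => //.
apply: le_trans (ler_normD _ _) _; apply: lerD => //.
by apply: le_trans (ler_normB _ _) _; apply: lerD.
Qed.

End Convergence.

Theorem theorem5 (R : realType) (M : mprk R 3)
    (hM : is_mprk 4 M) (hRK : rk_order 3 M) (hMPRK : mprk_order 3 M)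
    (N : nat) (F : pds R N) (hF : pc_pds 4 F) :
  dense_convergent 3 M F
    (fun (theta : R) (j : 'I_3) =>
       if j == ord0 then theta - (1 - bt_b M ord0) * theta ^+ 2
       else theta ^+ 2 * bt_b M j)
    (fun (theta : R) (yn sigma : 'rV[R]_N) =>
       (1 - theta) *: yn + theta *: sigma).
Proof. exact: (@dense_output_convergent R 2 M hM (rk_order_sum hRK) hMPRK N F hF). Qed.
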